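(* Let $G$ be a locally compact abelian group, $\gamma\in\Gamma$, $s\ge0$, and let $\alpha>s$ be such that $\xi\mapsto(1+\gamma(\xi)^2)^{-1}$ belongs to $L^\alpha(G^\wedge,\mu_{G^\wedge})$. Put $\alpha^*=\frac{2\alpha}{\alpha-s}$. Then $H^s_\gamma(G)\hookrightarrow L^{\alpha^*}_{\mu_G}(G)$: there is a constant $D(\gamma,s)$ such that every $f\in H^s_\gamma(G)$ lies in $L^{\alpha^*}_{\mu_G}(G)$ and \[ \|f\|_{L^{\alpha^*}_{\mu_G}(G)}\le D(\gamma,s)\,\|f\|_{H^s_\gamma(G)}. \]
   Context: $G$ is a locally compact abelian group with Haar measure $\mu_G$; $G^\wedge$ is its dual group (continuous homomorphisms $G\to\{z\in\mathbb C:|z|=1\}$, a locally compact abelian group under pointwise multiplication) with Haar measure $\mu_{G^\wedge}$ normalized so that the Plancherel theorem and Fourier inversion hold. For $f\in L^1_{\mu_G}(G)$, $\hat f(\xi)=\int_G\overline{\xi(x)}f(x)\,d\mu_G(x)$, extended to $L^2$ by Plancherel. $\Gamma$ is the set of functions $\gamma:G^\wedge\to[0,\infty)$ for which there is a constant $c_\gamma$ with $\gamma(\alpha\beta)\le c_\gamma[\gamma(\alpha)+\gamma(\beta)]$ for all $\alpha,\beta\in G^\wedge$. For $\gamma\in\Gamma$ and real $s\ge0$, $H^s_\gamma(G)$ is the set of $f\in L^2_{\mu_G}(G)$ with $\|f\|_{H^s_\gamma(G)}=\left(\int_{G^\wedge}(1+\gamma(\xi)^2)^s|\hat f(\xi)|^2\,d\mu_{G^\wedge}(\xi)\right)^{1/2}<\infty$.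 *)

(* Defs.v *)
From HB Require Import structures.
From mathcomp Require Import all_boot all_order all_algebra.
From mathcomp Require Import all_classical all_reals all_analysis.
From mathcomp Require Import complex.
Set Implicit Arguments. Unset Strict Implicit. Unset Printing Implicit Defensive.
Import Order.TTheory GRing.Theory Num.Theory.
Import numFieldNormedType.Exports.
Local Open Scope classical_set_scope.
Local Open Scope ring_scope.

Definition ptG (G : topologicalZmodType) : Type := G.
HB.instance Definition _ (G : topologicalZmodType) := Choice.on (ptG G).
HB.instance Definition _ (G : topologicalZmodType) := isPointed.Build (ptG G) 0.

Definition borelG (G : topologicalZmodType) :=
  @g_sigma_algebraType (ptG G) (@open G).

Section Dual.
Variables (R : realType) (G : topologicalZmodType).

Definition is_character (chi : G -> R[i]) : Prop :=
  [/\ continuous (fun x : G => complex.Re (chi x)),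
      continuous (fun x : G => complex.Im (chi x)),
      (forall x, Normc.normc (chi x) = 1) &
      (forall x y, chi (x + y) = chi x * chi y)].

Definition dual := {chi : G -> R[i] | `[< is_character chi >]}.

Lemma trivial_character : `[< is_character (fun _ : G => 1) >].
Proof.
apply/asboolP; split => //.
- exact: cst_continuous.
- exact: cst_continuous.
- by move=> x; rewrite Normc.normc1.
- by move=> x y; rewrite mulr1.
Qed.

Definition dual1 : dual := exist _ (fun _ : G => 1) trivial_character.

HB.instance Definition _ := Choice.on dual.
HB.instance Definition _ := isPointed.Build dual dual1.

(* Topology of the dual group: uniform convergence on compact subsets
   of G (= compact-open topology), generated by the sets
   { psi | forall x in K, |psi x - chi x| < eps }, K compact, eps > 0. *)
Definition dual_sb_index := ((dual * set G) * R)%type.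
Definition dual_sb_dom : set dual_sb_index :=
  [set i | compact i.1.2 /\ 0 < i.2].
Definition dual_sb (i : dual_sb_index) : set dual :=
  [set psi | forall x, i.1.2 x ->
     Normc.normc (sval psi x - sval i.1.1 x) < i.2].

HB.instance Definition _ :=
  @isSubBaseTopological.Build dual dual_sb_index dual_sb_dom dual_sb.

Definition dualB := @g_sigma_algebraType dual (@open dual).

Definition dual_mul_rel (psi eta phi : dual) : Prop :=
  forall x, sval psi x = sval eta x * sval phi x.

End Dual.

Section Haar.
Variables (R : realType) (G : topologicalZmodType).
Local Open Scope ereal_scope.

Definition haar_G (mu : {measure set (borelG G) -> \bar R}) : Prop :=
  [/\ (forall (a : G) (A : set (borelG G)), measurable A ->
         mu [set (a + x)%R | x in A] = mu A),
      (forall K : set G, compact K -> mu K < +oo),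
      (forall A : set (borelG G), measurable A ->
         mu A = ereal_inf [set mu U | U in [set U : set G | open U /\ A `<=` U]]),
      (forall U : set G, open U ->
         mu U = ereal_sup [set mu K | K in [set K : set G | compact K /\ K `<=` U]]) &
      mu [set: borelG G] != 0].

Definition haar_dual (nu : {measure set (dualB R G) -> \bar R}) : Prop :=
  [/\ (forall (eta : dual R G) (B : set (dualB R G)), measurable B ->
         nu [set psi | exists2 phi, B phi & dual_mul_rel psi eta phi] = nu B),
      (forall K : set (dual R G), compact K -> nu K < +oo),
      (forall B : set (dualB R G), measurable B ->
         nu B = ereal_inf [set nu U | U in
                  [set U : set (dual R G) | open U /\ B `<=` U]]),
      (forall U : set (dual R G), open U ->
         nu U = ereal_sup [set nu K | K in
                  [set K : set (dual R G) | compact K /\ K `<=` U]]) &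
      nu [set: dualB R G] != 0].
End Haar.

Section Lp.
Variables (R : realType) (d : measure_display) (T : measurableType d).
Variable (mu : {measure set T -> \bar R}).

Definition cmeasurable (f : T -> R[i]) : Prop :=
  measurable_fun [set: T] (fun x => complex.Re (f x)) /\
  measurable_fun [set: T] (fun x => complex.Im (f x)).

Definition cLnorm (p : R) (f : T -> R[i]) : \bar R :=
  Lnorm mu p%:E (fun x => (Normc.normc (f x))%:E).

Definition inLp (p : R) (f : T -> R[i]) : Prop :=
  cmeasurable f /\ (cLnorm p f < +oo)%E.

Definition inLp_real (p : R) (f : T -> R) : Prop :=
  measurable_fun [set: T] f /\ (Lnorm mu p%:E (fun x => (f x)%:E) < +oo)%E.
End Lp.

Section Fourier.
Variables (R : realType) (G : topologicalZmodType).
Variables (mu : {measure set (borelG G) -> \bar R})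
          (nu : {measure set (dualB R G) -> \bar R}).

Definition fourier (f : G -> R[i]) (xi : dual R G) : R[i] :=
  Complex
    (fine (\int[mu]_(x in [set: borelG G])
             (complex.Re (conjc (sval xi x) * f x))%:E))
    (fine (\int[mu]_(x in [set: borelG G])
             (complex.Im (conjc (sval xi x) * f x))%:E)).

Definition plancherel_normalized : Prop :=
  forall f : G -> R[i], inLp mu 1 f -> inLp mu 2 f ->
    cLnorm nu 2 (fourier f) = cLnorm mu 2 f.

Definition is_plancherel_transform (f : G -> R[i]) (g : dual R G -> R[i]) :
  Prop :=
  inLp nu 2 g /\
  exists fn : nat -> G -> R[i],
    [/\ (forall n, inLp mu 1 (fn n) /\ inLp mu 2 (fn n)),
        cLnorm mu 2 (fun x => fn n x - f x) @[n --> \oo] --> 0%E &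
        cLnorm nu 2 (fun xi => fourier (fn n) xi - g xi) @[n --> \oo] --> 0%E].
End Fourier.

Section Sobolev.
Variables (R : realType) (G : topologicalZmodType).

Definition in_Gamma (gamma : dual R G -> R) : Prop :=
  (forall xi, 0 <= gamma xi) /\
  exists c : R, forall a b ab : dual R G, dual_mul_rel ab a b ->
    gamma ab <= c * (gamma a + gamma b).

(* (int (1 + gamma^2)^s |g|^2 dnu)^(1/2), with g the Fourier transform *)
Definition Hs_norm (nu : {measure set (dualB R G) -> \bar R})
  (gamma : dual R G -> R) (s : R) (g : dual R G -> R[i]) : \bar R :=
  ((\int[nu]_(xi in [set: dualB R G])
      ((1 + gamma xi ^+ 2) `^ s * Normc.normc (g xi) ^+ 2)%:E) `^ (2^-1))%E.
End Sobolev.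

(* Main.v *)
(** Let p be the exponent conjugate to q = 2 alpha / (alpha - s).  Testing f against h = phi f with
phi >= 0, the Plancherel identities for f, h and f + h give
int |f| |h| <= int |f^| |h^|; in this form neither Fourier inversion nor the
surjectivity of the Plancherel transform is needed.  By Cauchy-Schwarz with the
weight (1 + gamma^2)^s everything reduces to
int (1 + gamma^2)^(-s) |h^|^2 <= C for all h with int |h|^p = 1.
For this, on the slice 2^(-j-1) < (1 + gamma^2)^(-1) <= 2^(-j) of the dual group
cut h at height 2^(j (alpha + s) / 2): the transform of the large part is bounded
by its L^1 norm, and the slice has measure O(2^(j alpha)), while the small part
is handled by Plancherel.  Pointwise in x, the resulting sums over j are geometric
and of size |h x|^p.  Taking h proportional to |f|^(q - 2) f on
1/n <= |f| <= n then bounds int |f|^q. *)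

Require Import Defs.
From HB Require Import structures.
From mathcomp Require Import all_boot all_order all_algebra.
From mathcomp Require Import all_classical all_reals all_analysis.
From mathcomp Require Import measurable_realfun complex.
From mathcomp Require Import ring lra.
Set Implicit Arguments. Unset Strict Implicit. Unset Printing Implicit Defensive.
Import Order.TTheory GRing.Theory Num.Theory.
Import numFieldNormedType.Exports.
Local Open Scope classical_set_scope.
Local Open Scope ring_scope.
Local Notation normc := Normc.normc.

(** * Complex-valued functions *)

Section ComplexModulus.
Variable R : realType.
Implicit Types (z w : R[i]) (r : R).

Lemma normc_ge0 z : 0 <= normc z.
Proof. by case: z => a b; exact: sqrtr_ge0. Qed.

Lemma normc_sqr z : normc z ^+ 2 = complex.Re z ^+ 2 + complex.Im z ^+ 2.
Proof. by case: z => a b; rewrite /= sqr_sqrtr// addr_ge0// sqr_ge0. Qed.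

Lemma normc_triangle z w : normc (z + w) <= normc z + normc w.
Proof. exact: (@le_normcD R). Qed.

Lemma normc_opp z : normc (- z) = normc z.
Proof. exact: (@normcN R). Qed.

Lemma normc_distC z w : normc (z - w) = normc (w - z).
Proof. by rewrite -normc_opp opprB. Qed.

Lemma normc_real r : normc (r%:C)%C = `|r|.
Proof. by rewrite /= expr0n addr0 sqrtr_sqr. Qed.

Lemma normc_conj z : normc (conjc z) = normc z.
Proof. by case: z => a b /=; rewrite sqrrN. Qed.

Lemma Re_le_normc z : `|complex.Re z| <= normc z.
Proof.
by rewrite -sqrtr_sqr -[leRHS]ger0_norm ?normc_ge0// -sqrtr_sqr ler_wsqrtr//
  normc_sqr lerDl sqr_ge0.
Qed.

Lemma Im_le_normc z : `|complex.Im z| <= normc z.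
Proof.
by rewrite -sqrtr_sqr -[leRHS]ger0_norm ?normc_ge0// -sqrtr_sqr ler_wsqrtr//
  normc_sqr lerDr sqr_ge0.
Qed.

Lemma normc_le_ReIm z : normc z <= `|complex.Re z| + `|complex.Im z|.
Proof.
rewrite -[leLHS]ger0_norm ?normc_ge0// -sqrtr_sqr normc_sqr.
rewrite -[leRHS]ger0_norm ?addr_ge0// -sqrtr_sqr ler_wsqrtr//.
rewrite sqrrD !real_normK ?num_real// lerD2r lerDl.
by rewrite mulrn_wge0// mulr_ge0.
Qed.

End ComplexModulus.

(** * Measurability and [L^p] seminorms of complex-valued functions *)

Section ComplexLp.
Context (R : realType) d (T : measurableType d) (mu : {measure set T -> \bar R}).
Implicit Types (f g : T -> R[i]) (p : R).

Lemma measurable_scaled_indic (A : set T) (c : R) : measurable A ->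
  measurable_fun [set: T] (fun x => (c * \1_A x)%:E).
Proof.
by move=> mA; apply/measurable_EFinP/measurable_funM => //; exact: measurable_indic.
Qed.

Lemma integral_scaled_indic (A : set T) (c : R) : 0 <= c -> measurable A ->
  (\int[mu]_x (c * \1_A x)%:E = c%:E * mu A)%E.
Proof.
move=> c0 mA; under eq_integral do rewrite EFinM.
rewrite ge0_integralZl_EFin//; last first.
  by apply/measurable_EFinP; exact: measurable_indic.
by rewrite integral_indic// setIT.
Qed.

Lemma measurable_normc f : cmeasurable f ->
  measurable_fun [set: T] (fun x => normc (f x)).
Proof.
move=> [mr mi]; have -> : (fun x => normc (f x)) =
    (fun x => Num.sqrt (complex.Re (f x) ^+ 2 + complex.Im (f x) ^+ 2)).
  by apply/funext => x; case: (f x).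
apply: (measurableT_comp (continuous_measurable_fun (@sqrt_continuous R))).
by apply: measurable_funD; exact: measurable_funX.
Qed.

Lemma cmeasurableD f g : cmeasurable f -> cmeasurable g ->
  cmeasurable (fun x => f x + g x).
Proof.
move=> [fr fi] [gr gi]; split.
  by under eq_fun do rewrite raddfD /=; exact: measurable_funD.
by under eq_fun do rewrite raddfD /=; exact: measurable_funD.
Qed.

Lemma cmeasurableN f : cmeasurable f -> cmeasurable (fun x => - f x).
Proof.
move=> [fr fi]; split.
  by under eq_fun do rewrite raddfN /=; exact: measurable_funN.
by under eq_fun do rewrite raddfN /=; exact: measurable_funN.
Qed.

Lemma cmeasurableB f g : cmeasurable f -> cmeasurable g ->
  cmeasurable (fun x => f x - g x).
Proof. by move=> mf /cmeasurableN; exact: cmeasurableD. Qed.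

Lemma cmeasurableM f g : cmeasurable f -> cmeasurable g ->
  cmeasurable (fun x => f x * g x).
Proof.
move=> [fr fi] [gr gi]; split.
  rewrite (_ : (fun x => _) = (fun x => complex.Re (f x) * complex.Re (g x)
     - complex.Im (f x) * complex.Im (g x))).
    by apply: measurable_funB; exact: measurable_funM.
  by apply/funext => x; case: (f x) => ? ?; case: (g x).
rewrite (_ : (fun x => _) = (fun x => complex.Re (f x) * complex.Im (g x)
   + complex.Im (f x) * complex.Re (g x))).
  by apply: measurable_funD; exact: measurable_funM.
by apply/funext => x; case: (f x) => ? ?; case: (g x).
Qed.

Lemma cmeasurable_real (r : T -> R) : measurable_fun [set: T] r ->
  cmeasurable (fun x => (r x)%:C%C).
Proof. by move=> mr; split=> //=; exact: measurable_cst. Qed.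

Lemma cLnorm_powR p f : p != 0 ->
  (cLnorm mu p f `^ p = \int[mu]_x (normc (f x) `^ p)%:E)%E.
Proof.
move=> p0; rewrite /cLnorm poweR_Lnorm//; apply: eq_integral => x _.
by rewrite abse_EFin poweR_EFin ger0_norm// normc_ge0.
Qed.

Lemma cLnormE p f : p != 0 ->
  (cLnorm mu p f = (\int[mu]_x (normc (f x) `^ p)%:E) `^ p^-1)%E.
Proof.
by move=> p0; rewrite -cLnorm_powR// -poweRrM mulfV// poweRe1// Lnorm_ge0.
Qed.

Lemma cLnorm2_sqr f :
  (cLnorm mu 2 f `^ 2 = \int[mu]_x (normc (f x) ^+ 2)%:E)%E.
Proof.
rewrite cLnorm_powR//; apply: eq_integral => x _.
by rewrite powR_mulrn// normc_ge0.
Qed.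

Lemma cLnorm1E f : cLnorm mu 1 f = (\int[mu]_x (normc (f x))%:E)%E.
Proof.
rewrite /cLnorm Lnorm1; apply: eq_integral => x _.
by rewrite abse_EFin ger0_norm// normc_ge0.
Qed.

(** The pointwise triangle inequality reduces this to Minkowski's inequality for the two real
    functions [normc (f x)] and [normc (g x)]. *)
Lemma cLnormD p f g : 1 <= p -> cmeasurable f -> cmeasurable g ->
  (cLnorm mu p (fun x => (f x + g x)%R) <= cLnorm mu p f + cLnorm mu p g)%E.
Proof.
move=> p1 mf mg; have p0 : p != 0 by rewrite gt_eqF// (lt_le_trans _ p1).
have mn := measurable_normc.
apply: le_trans (minkowski_EFin mu (mn _ mf) (mn _ mg) p1).
rewrite cLnormE// unlock; apply: gt0_ler_poweR.
- by rewrite invr_ge0 (le_trans _ p1).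
- by rewrite in_itv/= integral_ge0 ?leey// => x _; rewrite lee_fin powR_ge0.
- by rewrite in_itv/= integral_ge0 ?leey// => x _; exact: poweR_ge0.
have mpow (h : T -> R) : measurable_fun [set: T] h ->
    measurable_fun [set: T] (fun x => (`|h x| `^ p)%:E).
  move=> mh; apply/measurable_EFinP.
  apply: (measurableT_comp (measurable_powR p)).
  exact: measurableT_comp.
apply: ge0_le_integral => //.
- by move=> x _; rewrite lee_fin powR_ge0.
- have := mpow _ (mn _ (cmeasurableD mf mg)).
  by under eq_fun do rewrite ger0_norm ?normc_ge0//.
- exact: mpow (measurable_funD (mn _ mf) (mn _ mg)).
- move=> x _ /=; rewrite lee_fin ge0_ler_powR ?(le_trans _ p1)//.
    by rewrite nnegrE normc_ge0.
  by rewrite ger0_norm ?addr_ge0 ?normc_ge0// normc_triangle.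
Qed.

Lemma cLnorm_distC p f g :
  cLnorm mu p (fun x => f x - g x) = cLnorm mu p (fun x => g x - f x).
Proof. by apply: eq_Lnorm => x; rewrite normc_distC. Qed.

(** Squeeze between the norm of [f] minus, and plus, the distance from [F n] to [f]. *)
Lemma cvg_cLnorm p (F : nat -> T -> R[i]) f : 1 <= p ->
  (forall n, cmeasurable (F n)) -> cmeasurable f -> (cLnorm mu p f < +oo)%E ->
  cLnorm mu p (fun x => F n x - f x) @[n --> \oo] --> 0%E ->
  cLnorm mu p (F n) @[n --> \oo] --> cLnorm mu p f.
Proof.
move=> p1 mF mf foo F0.
have ffin : cLnorm mu p f \is a fin_num by rewrite ge0_fin_numE// Lnorm_ge0.
apply: (@squeeze_cvge _ _ _ _
  (fun n => cLnorm mu p f - cLnorm mu p (fun x => (F n x - f x)%R))%E _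
  (fun n => cLnorm mu p f + cLnorm mu p (fun x => (F n x - f x)%R))%E).
- apply: nearW => n; apply/andP; split.
    have := cLnormD p1 (mF n) (cmeasurableB mf (mF n)).
    rewrite (_ : (fun x => (F n x + _)%R) = f); last first.
      by apply/funext => x; rewrite addrC subrK.
    rewrite cLnorm_distC.
    have := Lnorm_ge0 mu p%:E (fun x => (normc (F n x - f x))%:E).
    rewrite -/(cLnorm mu p _).
    (* The distance may be infinite for some [n]; the lower bound is then [-oo]. *)
    case: (cLnorm mu p (fun x => _ - _)) => [r|//|//] _ fle.
      by rewrite leeBlDr.
    by rewrite -(fineK ffin) /= leNye.
  have := cLnormD p1 mf (cmeasurableB (mF n) mf).
  by rewrite (_ : (fun x => (f x + _)%R) = F n)//;
    apply/funext => x; rewrite addrC subrK.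
- rewrite -[X in _ --> X]sube0; apply: cvgeB => //; last exact: cvg_cst.
  by rewrite fin_num_adde_defl// fin_numN.
- rewrite -[X in _ --> X]adde0; apply: cvgeD => //; last exact: cvg_cst.
  by rewrite fin_num_adde_defl.
Qed.

Lemma inLpD p f g : 1 <= p -> inLp mu p f -> inLp mu p g ->
  inLp mu p (fun x => f x + g x).
Proof.
move=> p1 [mf foo] [mg goo]; split; first exact: cmeasurableD.
by rewrite (le_lt_trans (cLnormD p1 mf mg))// lte_add_pinfty.
Qed.

Lemma inLpN p f : inLp mu p f -> inLp mu p (fun x => - f x).
Proof.
move=> [mf foo]; split; first exact: cmeasurableN.
rewrite (_ : cLnorm _ _ _ = cLnorm mu p f)//.
by apply: eq_Lnorm => x; rewrite normc_opp.
Qed.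

End ComplexLp.

(** * Complex integrals, tame functions and truncation to level sets *)

Section ComplexIntegral.
Context (R : realType) d (T : measurableType d) (mu : {measure set T -> \bar R}).
Implicit Types (f g : T -> R[i]) (p : R).

(** Shaped so that [fourier] is an instance of it by conversion. *)
Definition cintegral f : R[i] :=
  Complex (fine (\int[mu]_x (complex.Re (f x))%:E)%E)
          (fine (\int[mu]_x (complex.Im (f x))%:E)%E).

Lemma inLp1_integrable f : inLp mu 1 f ->
  mu.-integrable [set: T] (fun x => (normc (f x))%:E).
Proof.
move=> [mf foo]; apply/integrableP; split.
  exact/measurable_EFinP/measurable_normc.
rewrite cLnorm1E in foo; under eq_integral do rewrite abse_EFin.
by under eq_integral do rewrite ger0_norm ?normc_ge0//.
Qed.

Lemma inLp1_integrable_Re f : inLp mu 1 f ->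
  mu.-integrable [set: T] (fun x => (complex.Re (f x))%:E).
Proof.
move=> f1; apply: le_integrable (inLp1_integrable f1) => //.
  by apply/measurable_EFinP; case: f1 => -[].
move=> x _; rewrite !abse_EFin lee_fin [leRHS]ger0_norm ?normc_ge0//.
exact: Re_le_normc.
Qed.

Lemma inLp1_integrable_Im f : inLp mu 1 f ->
  mu.-integrable [set: T] (fun x => (complex.Im (f x))%:E).
Proof.
move=> f1; apply: le_integrable (inLp1_integrable f1) => //.
  by apply/measurable_EFinP; case: f1 => -[].
move=> x _; rewrite !abse_EFin lee_fin [leRHS]ger0_norm ?normc_ge0//.
exact: Im_le_normc.
Qed.

Lemma cintegralD f g : inLp mu 1 f -> inLp mu 1 g ->
  cintegral (fun x => f x + g x) = cintegral f + cintegral g.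
Proof.
move=> f1 g1; rewrite /cintegral.
under eq_integral do rewrite raddfD /= EFinD.
under [X in Complex _ (fine X)]eq_integral do rewrite raddfD /= EFinD.
have [fr gr] := (inLp1_integrable_Re f1, inLp1_integrable_Re g1).
have [fi gi] := (inLp1_integrable_Im f1, inLp1_integrable_Im g1).
rewrite !integralD//.
by rewrite fineD ?integrable_fin_num// [X in Complex _ X]fineD ?integrable_fin_num.
Qed.

(** The real and imaginary parts are each bounded by the integral of the modulus, whence the factor
    2 instead of the sharp 1; it only enlarges the final constant. *)
Lemma normc_cintegral_le f : inLp mu 1 f ->
  ((normc (cintegral f))%:E <= 2%:E * \int[mu]_x (normc (f x))%:E)%E.
Proof.
move=> f1; have fn := inLp1_integrable f1.
have fr := inLp1_integrable_Re f1; have fi := inLp1_integrable_Im f1.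
apply: (@le_trans _ _ ((`|complex.Re (cintegral f)|)%:E + (`|complex.Im (cintegral f)|)%:E)%E).
  by rewrite -EFinD lee_fin; exact: normc_le_ReIm.
rewrite -[2%:E]/(1 + 1)%:E EFinD ge0_muleDl ?mul1e//.
rewrite /= -!abse_EFin !fineK ?integrable_fin_num//.
apply: leeD; apply: (le_trans (le_abse_integral _ _ _)) => //.
- exact: measurable_int fr.
- apply: ge0_le_integral => //.
  + exact: measurableT_comp (measurable_int _ fr).
  + exact: measurable_int fn.
  + by move=> x _; rewrite lee_fin Re_le_normc.
- exact: measurable_int fi.
- apply: ge0_le_integral => //.
  + exact: measurableT_comp (measurable_int _ fi).
  + exact: measurable_int fn.
  + by move=> x _; rewrite lee_fin Im_le_normc.
Qed.

(** Bounded and carried by a set of finite measure. Such functions lie in every [L^p] with [p > 0],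
    so [fourier] and Plancherel both apply to them, and cut-offs stay in the class. *)
Definition tame f := cmeasurable f /\ exists (M : R) (E : set T),
  [/\ 0 <= M, measurable E, (mu E < +oo)%E &
      forall x, normc (f x) <= M * \1_E x].

Lemma tame_inLp p f : 0 < p -> tame f -> inLp mu p f.
Proof.
move=> p0 [mf [M [E [M0 mE Eoo fM]]]]; split => //.
rewrite cLnormE ?gt_eqF// poweR_lty//.
apply: (@le_lt_trans _ _ (\int[mu]_x (M `^ p * \1_E x)%:E)%E).
  apply: ge0_le_integral => //.
  - by move=> x _; rewrite lee_fin powR_ge0.
  - apply/measurable_EFinP.
    by apply: (measurableT_comp (measurable_powR p)); exact: measurable_normc.
  - exact: measurable_scaled_indic.
  - move=> x _; rewrite lee_fin; have := fM x; rewrite !indicE.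
    case: (x \in E); rewrite /= ?mulr0 ?mulr1 => fx.
      by rewrite ge0_ler_powR ?(ltW p0)// nnegrE normc_ge0.
    have /eqP -> : normc (f x) == 0 by rewrite eq_le fx normc_ge0.
    by rewrite powR0// gt_eqF.
by rewrite integral_scaled_indic ?powR_ge0// lte_mul_pinfty// ?lee_fin ?powR_ge0.
Qed.

Lemma tameM (r : T -> R) f : measurable_fun [set: T] r ->
  (forall x, `|r x| <= 1) -> tame f -> tame (fun x => (r x)%:C%C * f x).
Proof.
move=> mr r1 [mf [M [E [M0 mE Eoo fM]]]]; split.
  exact: cmeasurableM (cmeasurable_real mr) mf.
exists M, E; split => // x; rewrite Normc.normcM normc_real.
by apply: le_trans (fM x); rewrite ler_piMl// normc_ge0.
Qed.

(** The upper bound makes [f] bounded on the level, the lower bound gives the level finite measure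
    when [f] is in some [L^p]. The levels increase to the set where [f] does not vanish. *)
Definition level f n := [set x | n.+1%:R^-1 <= normc (f x) <= n.+1%:R].

Lemma measurable_level f n : cmeasurable f -> measurable (level f n).
Proof.
move=> mf; rewrite -[level f n]setTI.
exact: (measurable_normc mf measurableT (measurable_itv `[n.+1%:R^-1, n.+1%:R]%R)).
Qed.

(** Chebyshev's inequality at height [1 / (n + 1)]. *)
Lemma level_lty p f n : 0 < p -> inLp mu p f -> (mu (level f n) < +oo)%E.
Proof.
move=> p0 [mf foo].
have foo' : (\int[mu]_x (normc (f x) `^ p)%:E < +oo)%E.
  by rewrite -cLnorm_powR ?gt_eqF// poweR_lty.
have c0 : 0 < (n.+1%:R^-1 : R) `^ p by rewrite powR_gt0// invr_gt0.
have mL := measurable_level n mf.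
rewrite -(@lte_pmul2l _ ((n.+1%:R^-1) `^ p)%:E) ?lte_fin//.
rewrite gt0_muley ?lte_fin//; apply: le_lt_trans foo'.
rewrite -integral_scaled_indic ?(ltW c0)//; apply: ge0_le_integral => //.
- exact: measurable_scaled_indic.
- apply/measurable_EFinP.
  by apply: (measurableT_comp (measurable_powR p)); exact: measurable_normc.
- move=> x _; rewrite lee_fin indicE.
  have [|_] := boolP (x \in level f n); last by rewrite mulr0 powR_ge0.
  rewrite inE => /andP[h _]; rewrite mulr1 ge0_ler_powR ?(ltW p0)// nnegrE.
    by rewrite invr_ge0.
  exact: normc_ge0.
Qed.

Lemma level_near f x : f x != 0 -> \forall n \near \oo, level f n x.
Proof.
move=> fx0; have fx : 0 < normc (f x).
  rewrite lt_neqAle normc_ge0 andbT eq_sym.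
  by apply: contra fx0 => /eqP/Normc.eq0_normc ->.
near=> n; have nS : (n%:R : R) <= n.+1%:R by rewrite ler_nat.
apply/andP; split; last by apply: le_trans nS; near: n; exact: nbhs_infty_ger.
rewrite -[leRHS]invrK lef_pV2 ?posrE ?invr_gt0//.
by apply: le_trans nS; near: n; exact: nbhs_infty_ger.
Unshelve. all: by end_near.
Qed.

Lemma nondecreasing_level f : nondecreasing_seq (fun n => level f n).
Proof.
move=> m n mn; apply/subsetPset => x /andP[h1 h2]; apply/andP; split.
  by apply: le_trans h1; rewrite lef_pV2 ?posrE// ler_nat.
by rewrite (le_trans h2)// ler_nat.
Qed.


(** Dominated convergence with majorant [|r|]. Levels of [f] never reach the zeros of [f], so [r]
    has to vanish there. *)
Lemma cvg_integral_level f (r : T -> R) : cmeasurable f ->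
  mu.-integrable [set: T] (EFin \o r) -> (forall x, f x = 0 -> r x = 0) ->
  fine (\int[mu]_x (\1_(level f n) x * r x)%:E)%E @[n --> \oo] -->
  fine (\int[mu]_x (r x)%:E)%E.
Proof.
move=> mf ir r0; apply: fine_cvg; rewrite fineK ?(integrable_fin_num measurableT ir)//.
have mr := measurable_int _ ir.
have [] // := @dominated_convergence _ _ _ mu _ measurableT
  (fun n x => (\1_(level f n) x * r x)%:E) (EFin \o r) (fun x => `|(r x)%:E|%E) _ _ _ _ _.
- move=> n; apply/measurable_EFinP; apply: measurable_funM.
    by apply: measurable_indic; exact: measurable_level.
  exact/measurable_EFinP.
- apply: aeW => x _; apply: cvg_near_cst.
  have [fx0|fx0] := eqVneq (f x) 0.
    by apply: nearW => n; rewrite /= (r0 _ fx0) mulr0.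
  apply: filterS (level_near fx0) => n xn /=.
  by rewrite indicE mem_set// mul1r.
- exact: integrable_abse ir.
- apply: aeW => x n _; rewrite !abse_EFin lee_fin normrM indicE ler_piMl//.
  by rewrite normr_nat; case: (_ \in _).
Qed.

End ComplexIntegral.

(** * The Fourier transform of an integrable function *)

(** Open intervals generate the Borel sets of the line. A family [O] of sets in place of a topology
    lets the lemma serve both [borelG] and [dualB]. *)
Lemma measurable_of_open_preimage (R : realType) (T : pointedType)
    (O : set (set T)) (f : T -> R) :
  (forall U : set R, open U -> O (f @^-1` U)) ->
  measurable_fun [set: g_sigma_algebraType O] f.
Proof.
move=> fO; apply: (measurability _ (RGenOpens.measurableE R)).
move=> _ [_ [a [b ->]] <-]; rewrite setTI; apply: sub_sigma_algebra.
by apply: fO; exact: interval_open.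
Qed.

Section FourierOnGroup.
Variables (R : realType) (G : topologicalZmodType).
Variable mu : {measure set (borelG G) -> \bar R}.
Implicit Types (f h : G -> R[i]) (xi : dual R G).

Lemma cmeasurable_character xi :
  @cmeasurable R _ (borelG G) (fun x => conjc (sval xi x)).
Proof.
have /asboolP [cr ci _ _] := svalP xi; split.
  rewrite (_ : (fun x => _) = fun x => complex.Re (sval xi x)).
    apply: measurable_of_open_preimage => U oU.
    by move/continuousP : cr; exact.
  by apply/funext => x; case: (sval xi x).
rewrite (_ : (fun x => _) = fun x => - complex.Im (sval xi x)); last first.
  by apply/funext => x; case: (sval xi x).
apply: measurable_funN.
apply: measurable_of_open_preimage => U oU.
by move/continuousP : ci; exact.
Qed.

Lemma normc_character xi x : normc (sval xi x) = 1.
Proof. by have /asboolP [_ _ /(_ x)] := svalP xi. Qed.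

Lemma inLp_character p f xi : p != 0 -> inLp mu p f ->
  inLp mu p (fun x => conjc (sval xi x) * f x).
Proof.
move=> p0 [mf foo]; split; first exact: cmeasurableM (cmeasurable_character xi) mf.
rewrite (_ : cLnorm _ _ _ = cLnorm mu p f)//; apply: eq_Lnorm => x.
by rewrite Normc.normcM normc_conj normc_character mul1r.
Qed.

Lemma fourierE f xi :
  fourier mu f xi = cintegral mu (fun x : borelG G => conjc (sval xi x) * f x).
Proof. by []. Qed.

Lemma fourierD f h xi : inLp mu 1 f -> inLp mu 1 h ->
  fourier mu (fun x => f x + h x) xi = fourier mu f xi + fourier mu h xi.
Proof.
move=> f1 h1; have n0 : (1 : R) != 0 by exact: oner_neq0.
rewrite !fourierE -cintegralD; try exact: inLp_character.
by congr (cintegral mu _); apply/funext => x; rewrite mulrDr.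
Qed.

Lemma normc_fourier_le f xi : inLp mu 1 f ->
  ((normc (fourier mu f xi))%:E <= 2%:E * \int[mu]_x (normc (f x))%:E)%E.
Proof.
move=> f1; have n0 : (1 : R) != 0 by exact: oner_neq0.
have := normc_cintegral_le (inLp_character xi n0 f1).
by under eq_integral do rewrite Normc.normcM normc_conj normc_character mul1r.
Qed.

Hypotheses (hG : hausdorff_space G) (muH : haar_G mu).

(** Outer regularity at [E] gives [U], inner regularity at the open set [U] gives [K]; thus [K]
    approximates [U] and need not lie in [E]. Compact sets are Borel because the group is
    Hausdorff. *)
Lemma haar_regular (E : set (borelG G)) (e : R) : measurable E ->
  (mu E < +oo)%E -> 0 < e ->
  exists U K : set G, [/\ @measurable _ (borelG G) U, @measurable _ (borelG G) K,
    compact K & [/\ E `<=` U, K `<=` U, (mu U < +oo)%E & (mu (U `\` K) < e%:E)%E]].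
Proof.
move=> mE Eoo e0; have [_ Koo outer inner _] := muH.
have mopen (U : set G) : open U -> @measurable _ (borelG G) U.
  by move=> oU; exact: sub_sigma_algebra.
have [U [oU EU] Uoo] : exists2 U : set G, open U /\ E `<=` U & (mu U < +oo)%E.
  move: Eoo; rewrite outer// => /ereal_inf_lt [_ [U [oU EU] <-] Uoo].
  by exists U.
have Ufin : mu U \is a fin_num by rewrite ge0_fin_numE.
have [K [cK KU] KUe] : exists2 K : set G, compact K /\ K `<=` U &
    (mu U - e%:E < mu K)%E.
  have : (mu U - e%:E < mu U)%E by rewrite lteBlDr// lteDl// lte_fin.
  rewrite {2}inner// => /ereal_sup_gt [_ [K [cK KU] <-] KUe].
  by exists K.
have mK : @measurable _ (borelG G) K.
  rewrite -[K]setCK; apply: measurableC; apply: mopen.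
  by apply: closed_openC; exact: compact_closed.
exists U, K; split; [exact: mopen|exact: mK|exact: cK|split => //].
rewrite measureD//; [|exact: mopen].
rewrite (setIidr KU) lteBlDr; last by rewrite ge0_fin_numE// Koo.
by rewrite addeC -lteBlDr.
Qed.

Lemma open_dual_sb (i : dual_sb_index R G) : dual_sb_dom i -> open (dual_sb i).
Proof.
move=> Di; exists [set dual_sb i]; last by rewrite bigcup_set1.
by move=> _ ->; exact: finI_from1.
Qed.

(** The integrand of the difference is small on a compact [K] because [eta] is uniformly close to
    [xi] there. Off [K] it is at most [2 * M] on a set of small measure, and it vanishes outside
    [E]. *)
Lemma fourier_near f xi (e : R) : @tame R _ (borelG G) mu f -> 0 < e ->
  \forall eta \near xi, normc (fourier mu f eta - fourier mu f xi) < e.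
Proof.
move=> tf e0; have [mf [M [E [M0 mE Eoo fM]]]] := tf.
have f1 : @inLp R _ (borelG G) mu 1 f by exact: tame_inLp.
have n0 : (1 : R) != 0 by exact: oner_neq0.
(* With [dl = k / (u + 1)] the final bound is [2 * (dl * M * u + 2 * M * k) <= 6 * M * k < e].
   Adding 1 to [M] and to [u] keeps the denominators positive. *)
pose k := e / (8 * (M + 1)).
have k0 : 0 < k by rewrite divr_gt0// mulr_gt0// ltr_wpDl.
have [U [K [mU mK cK [EU KU Uoo UKk]]]] := haar_regular mE Eoo k0.
pose u := fine (mu U); have u0 : 0 <= u by rewrite fine_ge0.
have uE : mu U = u%:E by rewrite fineK// ge0_fin_numE.
pose dl := k / (u + 1).
have dl0 : 0 < dl by rewrite divr_gt0// ltr_wpDl.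
near=> eta.
(* The compact-open topology enters here: the subbasic set of [(xi, K, dl)] is a neighbourhood of
   [xi]. *)
have near_K x : K x -> normc (sval eta x - sval xi x) < dl.
  have : dual_sb (xi, K, dl) eta.
    near: eta; apply: open_nbhs_nbhs; split; first exact: open_dual_sb.
    by move=> x _ /=; rewrite subrr Normc.normc0.
  by move/(_ x).
pose g (x : borelG G) := conjc (sval eta x) * f x + - (conjc (sval xi x) * f x).
have g1 : inLp mu 1 g.
  by apply: inLpD => //; [|apply: inLpN]; exact: inLp_character.
have -> : fourier mu f eta - fourier mu f xi = cintegral mu g.
  apply/eqP; rewrite subr_eq fourierE [in eqbRHS]fourierE -cintegralD//; last first.
    exact: inLp_character.
  by apply/eqP; congr (cintegral mu _); apply/funext => x; rewrite subrK.
rewrite -lte_fin; apply: le_lt_trans (normc_cintegral_le g1) _.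
have mUK : @measurable _ (borelG G) (U `\` K) by exact: measurableD.
apply: (@le_lt_trans _ _ (2%:E * \int[mu]_x ((dl * M * \1_U x)%:E +
    (2 * M * \1_(U `\` K) x)%:E))%E).
  rewrite lee_pmul2l//; apply: ge0_le_integral => //.
  - by move=> x _; rewrite lee_fin normc_ge0.
  - by apply/measurable_EFinP; apply: measurable_normc; case: g1.
  - by apply: emeasurable_funD; exact: measurable_scaled_indic.
  move=> x _; rewrite -EFinD lee_fin /g -mulrBl Normc.normcM.
  have -> : normc (conjc (sval eta x) - conjc (sval xi x)) =
            normc (sval eta x - sval xi x) by rewrite -rmorphB normc_conj.
  have := fM x; rewrite !indicE.
  have [xE|xE] := boolP (x \in E); last first.
    rewrite mulr0 => fx0.
    have /eqP -> : normc (f x) == 0 by rewrite eq_le fx0 normc_ge0.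
    by rewrite mulr0 addr_ge0// mulr_ge0// mulr_ge0// ltW.
  rewrite mulr1 => fxM.
  have xU : U x by apply: EU; rewrite inE in xE.
  rewrite (mem_set xU) mulr1.
  have [xK|xK] := pselect (K x).
    rewrite memNset; last by case.
    by rewrite mulr0 addr0 ler_pM ?normc_ge0// ltW// near_K.
  rewrite mem_set// mulr1; apply: ler_wpDl; first by rewrite mulr_ge0 ?(ltW dl0).
  apply: ler_pM; rewrite ?normc_ge0//; apply: le_trans (normc_triangle _ _) _.
  rewrite normc_opp !normc_character; lra.
have dlM : 0 <= dl * M by rewrite mulr_ge0// ltW.
have M2 : 0 <= 2 * M by rewrite mulr_ge0.
rewrite ge0_integralD//; last 4 first.
- by move=> x _; rewrite lee_fin mulr_ge0.
- exact: measurable_scaled_indic.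
- by move=> x _; rewrite lee_fin mulr_ge0.
- exact: measurable_scaled_indic.
rewrite (integral_scaled_indic mu dlM mU) (integral_scaled_indic mu M2 mUK) uE.
apply: (@le_lt_trans _ _ (2%:E * ((dl * M * u)%:E + (2 * M * k)%:E))%E).
  rewrite lee_pmul2l// EFinM leeD2l// [X in (_ <= X)%E]EFinM lee_wpmul2l ?lee_fin ?mulr_ge0//.
  exact: ltW.
rewrite -EFinD -EFinM lte_fin.
have h1 : dl * M * u <= k * M.
  have -> : dl * M * u = k * M * (u / (u + 1)) by rewrite /dl; ring.
  apply: ler_piMr; first by rewrite mulr_ge0// ltW.
  by rewrite ler_pdivrMr ?mul1r ?lerDl// ltr_wpDl.
have h2 : k * (M + 1) = e / 8.
  by rewrite /k; field; rewrite gt_eqF// ltr_wpDl.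
by nra.
Unshelve. all: by end_near.
Qed.

(** By [fourier_near] the real and imaginary parts of the transform are continuous. *)
Lemma cmeasurable_fourier_tame f : @tame R _ (borelG G) mu f ->
  @cmeasurable R _ (dualB R G) (fourier mu f).
Proof.
move=> tf; split; apply: measurable_of_open_preimage => U oU.
  suff /continuousP : continuous (fun xi => complex.Re (fourier mu f xi)) by exact.
  move=> xi; apply/(@cvgrPdist_lt _ _ _ _ (nbhs_filter (xi : dual R G))) => e e0.
  have := fourier_near xi tf e0; apply: filterS => eta.
  by apply: le_lt_trans; rewrite distrC -raddfB; exact: Re_le_normc.
suff /continuousP : continuous (fun xi => complex.Im (fourier mu f xi)) by exact.
move=> xi; apply/(@cvgrPdist_lt _ _ _ _ (nbhs_filter (xi : dual R G))) => e e0.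
have := fourier_near xi tf e0; apply: filterS => eta.
by apply: le_lt_trans; rewrite distrC -raddfB; exact: Im_le_normc.
Qed.

(** The truncations of [f] to its levels are tame, and their transforms converge pointwise to that
    of [f]. *)
Lemma cmeasurable_fourier f : @inLp R _ (borelG G) mu 1 f ->
  @cmeasurable R _ (dualB R G) (fourier mu f).
Proof.
move=> f1; have mf : @cmeasurable R _ (borelG G) f by case: f1.
have n0 : (1 : R) != 0 by exact: oner_neq0.
pose F n (x : borelG G) := (\1_(@level R _ (borelG G) f n) x)%:C%C * f x.
have tF n : tame mu (F n).
  split.
    apply: cmeasurableM => //; apply: cmeasurable_real.
    by apply: measurable_indic; exact: measurable_level.
  exists n.+1%:R, (@level R _ (borelG G) f n); split => //.
  - exact: measurable_level.
  - by apply: level_lty f1.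
  - move=> x; rewrite Normc.normcM normc_real normr_nat mulrC.
    rewrite !indicE; have [|_] := boolP (x \in _); last by rewrite !mulr0.
    by rewrite inE => /andP[_ ?]; rewrite !mulr1.
have mF n := cmeasurable_fourier_tame (tF n).
have fE n xi x : conjc (sval xi x) * F n x =
    (\1_(@level R _ (borelG G) f n) x)%:C%C * (conjc (sval xi x) * f x).
  by rewrite /F mulrCA.
have f0 xi x : f x = 0 -> conjc (sval xi x) * f x = 0 by move=> ->; rewrite mulr0.
split.
  apply: (@measurable_fun_cvg _ (dualB R G) R setT
    (fun n xi => complex.Re (fourier mu (F n) xi))).
    by move=> n; case: (mF n).
  move=> xi _; have ir := inLp1_integrable_Re (inLp_character xi n0 f1).
  have := cvg_integral_level mf ir.
  have hz x : f x = 0 -> complex.Re (conjc (sval xi x) * f x) = 0 by move=> /(f0 xi) ->.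
  move=> /(_ hz); rewrite [X in _ -> X --> _](_ : _ =
     (fun n => fine (\int[mu]_x (\1_(@level R _ (borelG G) f n) x *
        complex.Re (conjc (sval xi x) * f x))%:E)%E) @ \oo)//.
  congr (_ @ \oo); apply/funext => n; congr fine; apply: eq_integral => x _.
  by congr EFin; rewrite fE; case: (_ * f x) => a b /=; rewrite mul0r subr0.
apply: (@measurable_fun_cvg _ (dualB R G) R setT
    (fun n xi => complex.Im (fourier mu (F n) xi))).
  by move=> n; case: (mF n).
move=> xi _; have ir := inLp1_integrable_Im (inLp_character xi n0 f1).
have := cvg_integral_level mf ir.
have hz x : f x = 0 -> complex.Im (conjc (sval xi x) * f x) = 0 by move=> /(f0 xi) ->.
move=> /(_ hz); rewrite [X in _ -> X --> _](_ : _ =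
   (fun n => fine (\int[mu]_x (\1_(@level R _ (borelG G) f n) x *
      complex.Im (conjc (sval xi x) * f x))%:E)%E) @ \oo)//.
congr (_ @ \oo); apply/funext => n; congr fine; apply: eq_integral => x _.
by congr EFin; rewrite fE; case: (_ * f x) => a b /=; rewrite mul0r addr0.
Qed.

End FourierOnGroup.

(** * Weighted interpolation *)

Section GeometricSums.
Variable R : realType.
Implicit Types (r q t : R) (n : nat).

Lemma powR_exprn t q n : 0 <= t -> (t ^+ n) `^ q = (t `^ q) ^+ n.
Proof.
by move=> t0; rewrite -!powR_mulrn ?powR_ge0// -!powRrM mulrC.
Qed.

Lemma geometric_sum_lt q t n : 1 < q -> 0 <= t ->
  \sum_(j < n) (if q ^+ j < t then q ^+ j else 0) <= q * t / (q - 1).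
Proof.
move=> q1 t0; have q0 : 0 < q by rewrite (lt_trans _ q1).
rewrite ler_pdivlMr ?subr_gt0//.
(* The minimum makes the induction close: a term is added only if [q ^+ n < t], and then [q ^+ n.+1]
   is still at most [q * t]. *)
suff : (\sum_(j < n) (if q ^+ j < t then q ^+ j else 0)) * (q - 1) <=
       Num.min (q ^+ n) (q * t) by rewrite le_min => /andP[].
elim: n => [|n ih]; first by rewrite big_ord0 mul0r le_min ler01 mulr_ge0// ltW.
move: ih; rewrite big_ord_recr/= mulrDl !le_min => /andP[ih1 ih2].
have qn : 0 < q ^+ n by rewrite exprn_gt0.
case: ifPn => [qt|qt]; rewrite exprS.
  by have := ler_wpM2l (ltW q0) (ltW qt) => h; apply/andP; split; nra.
rewrite mul0r addr0 ih2 andbT; nra.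
Qed.

Lemma geometric_sum_le q t n : 0 <= q < 1 -> 0 <= t ->
  \sum_(j < n) (if q ^+ j <= t then q ^+ j else 0) <= t / (1 - q).
Proof.
move=> /andP[q0 q1] t0; rewrite ler_pdivlMr ?subr_gt0//.
(* Terms are counted only once [q ^+ j] has dropped to [t]. Until then the right-hand side is 0;
   afterwards it telescopes. *)
suff : (\sum_(j < n) (if q ^+ j <= t then q ^+ j else 0)) * (1 - q) <=
       t - Num.min (q ^+ n) t.
  move=> /le_trans; apply; rewrite lerBlDr lerDl le_min t0 andbT exprn_ge0//.
elim: n => [|n ih]; first by rewrite big_ord0 mul0r subr_ge0 ge_min lexx orbT.
rewrite big_ord_recr/= mulrDl.
have qn : 0 <= q ^+ n by rewrite exprn_ge0.
have qS : q ^+ n.+1 <= q ^+ n by rewrite exprS ler_piMl// ltW.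
case: ifPn => [qt|]; last first.
  rewrite -ltNge => qt; move: ih; rewrite (min_idPr (ltW qt)) subrr mul0r addr0.
  by move=> /le_trans; apply; rewrite subr_ge0 ge_min lexx orbT.
move: ih; rewrite (min_idPl qt) (min_idPl (le_trans qS qt)) exprS => ih; nra.
Qed.

Lemma dyadic_between t : 0 < t <= 1 ->
  exists n, 2^-1 ^+ n.+1 < t <= 2^-1 ^+ n.
Proof.
move=> /andP[t0 t1].
have ex : exists n, 2^-1 ^+ n.+1 < t.
  exists (Num.bound t^-1); rewrite exprVn invf_plt ?posrE ?exprn_gt0//.
  have /archi_boundP/lt_le_trans : 0 <= t^-1 by rewrite invr_ge0 ltW.
  by apply; rewrite -natrX ler_nat ltnW// ltnW// ltn_expl.
(* Minimality gives the upper bound, except at index 0, where it is [t <= 1]. *)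
exists (ex_minn ex); case: ex_minnP => -[|m] mt mmin; rewrite mt/=.
  by rewrite expr0.
by rewrite leNgt; apply/negP => /mmin; rewrite ltnn.
Qed.

End GeometricSums.

(** * Slicing and truncation for an abstract additive operator, [L^1]-to-sup bounded and
    [L^2]-isometric *)

Section Interpolation.
Context (R : realType) d1 (T1 : measurableType d1) d2 (T2 : measurableType d2).
Variables (mu : {measure set T1 -> \bar R}) (nu : {measure set T2 -> \bar R}).
Variable F : (T1 -> R[i]) -> T2 -> R[i].
Hypothesis F_meas : forall h, tame mu h -> cmeasurable (F h).
Hypothesis F_add : forall h k xi, tame mu h -> tame mu k ->
  F (fun x => h x + k x) xi = F h xi + F k xi.
Hypothesis F_sup : forall h xi, tame mu h ->
  ((normc (F h xi))%:E <= 2%:E * \int[mu]_x (normc (h x))%:E)%E.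
Hypothesis F_L2 : forall h, tame mu h ->
  (\int[nu]_xi (normc (F h xi) ^+ 2)%:E = \int[mu]_x (normc (h x) ^+ 2)%:E)%E.

Variables (u : T2 -> R) (s alpha : R).
Hypotheses (u_meas : measurable_fun [set: T2] u) (u01 : forall xi, 0 < u xi <= 1).
Hypothesis u_int : (\int[nu]_xi (u xi `^ alpha)%:E < +oo)%E.
Hypotheses (s0 : 0 < s) (s_alpha : s < alpha).

Let p := 2 * alpha / (alpha + s).
(** Growth rates in the slice index [j]: the weight [u ^ s] is at most [sigma ^+ j], the measure of
    the slice is [O(kap ^+ j)], and [h] is cut at height [lam ^+ j]. The rate [rho] is the geometric
    mean of [sigma * kap] and 1, as [sigma_kap] records. *)
Let rho : R := 2 `^ ((alpha - s) / 2).
Let sigma : R := 2 `^ (- s).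
Let lam : R := 2 `^ ((alpha + s) / 2).
Let kap : R := 2 `^ alpha.
Let A : R := fine (\int[nu]_xi (u xi `^ alpha)%:E)%E.

Let alpha0 : 0 < alpha. Proof. exact: lt_trans s0 s_alpha. Qed.
Let as0 : alpha + s != 0. Proof. by rewrite gt_eqF// addr_gt0. Qed.

Let rho1 : 1 < rho.
Proof.
rewrite /rho /powR pnatr_eq0 /= expR_gt1 mulr_gt0 ?ln_gt0 ?ltr1n//.
by rewrite divr_gt0// subr_gt0.
Qed.

Let sigma01 : 0 <= sigma < 1.
Proof.
rewrite powR_ge0 /sigma /powR pnatr_eq0 /= expR_lt1 mulNr oppr_lt0.
by rewrite mulr_gt0 ?ln_gt0 ?ltr1n.
Qed.

Let lam_rho : lam `^ (p - 1) = rho.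
Proof. by rewrite /lam /rho -powRrM; congr powR; rewrite /p; field. Qed.

Let lam_sigma : lam `^ (p - 2) = sigma.
Proof. by rewrite /lam /sigma -powRrM; congr powR; rewrite /p; field. Qed.

Let sigma_kap : sigma * kap = rho ^+ 2.
Proof.
rewrite /sigma /kap /rho -powRD; last by rewrite pnatr_eq0 implybT.
by rewrite -powR_mulrn ?powR_ge0// -powRrM; congr powR; field.
Qed.

Let p12 : 1 < p < 2.
Proof.
have as1 : 0 < alpha + s by rewrite addr_gt0.
apply/andP; split; rewrite /p; [rewrite ltr_pdivlMr//|rewrite ltr_pdivrMr//].
  by rewrite mul1r mulr2n mulrDl !mul1r ltrD2l.
by rewrite mulrDr ltrDl mulr_gt0.
Qed.

(** The 8 is [2 * 2 ^ 2]: a 2 from [(a + b)^2 <= 2 a^2 + 2 b^2] and the square of the 2 in [F_sup].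
    The extra [kap] comes from the exponent [j.+1] in [slice_le]. In [C] the fractions carry the
    bounds for the two geometric sums. *)
Let C1 : R := 8 * A * kap.
Let C : R := C1 * (rho / (rho - 1)) + 2 / (1 - sigma).

(* The exponents are chosen so that [rho = lam `^ (p - 1)] and
[sigma = lam `^ (p - 2)]: both conditions below become conditions on the terms of
the geometric sums themselves. *)
Let pointwise (t : R) n : 0 <= t ->
  \sum_(j < n) (C1 * (if lam ^+ j < t then rho ^+ j * t else 0) +
      2 * (if t <= lam ^+ j then sigma ^+ j * t ^+ 2 else 0)) <= C * t `^ p.
Proof.
rewrite le_eqVlt => /predU1P[<-|t0].
  rewrite (powR0 _) ?mulr0; last by rewrite gt_eqF// (lt_trans ltr01)//; case/andP: p12.
  rewrite big1// => j _; rewrite expr0n/= !mulr0 !if_same.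
  by rewrite !mulr0 ?addr0.
have [p1 p2] := andP p12.
have lam0 : 0 < lam by rewrite powR_gt0.
have C10 : 0 <= C1 by rewrite !mulr_ge0 ?powR_ge0// fine_ge0// integral_ge0// => x _;
  rewrite lee_fin powR_ge0.
have tp : t `^ (p - 1) * t = t `^ p.
  by rewrite -{2}[t]powRr1 ?(ltW t0)// -powRD ?subrK ?(gt_eqF t0) ?implybT.
have tp2 : t `^ (p - 2) * t ^+ 2 = t `^ p.
  by rewrite -powR_mulrn ?(ltW t0)// -powRD ?subrK ?(gt_eqF t0) ?implybT.
rewrite big_split/= -!mulr_sumr /C [leRHS]mulrDl; apply: lerD.
  rewrite -mulrA ler_wpM2l//.
  apply: (@le_trans _ _ (t * \sum_(j < n)
      (if rho ^+ j < t `^ (p - 1) then rho ^+ j else 0))).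
    rewrite mulr_sumr; apply: ler_sum => j _.
    have rj : 0 <= rho ^+ j by rewrite exprn_ge0// powR_ge0.
    case: ifPn => [ltj|_]; last by rewrite mulr_ge0 ?(ltW t0)//; case: ifP.
    rewrite -lam_rho -powR_exprn ?(ltW lam0)// gt0_ltr_powR ?subr_gt0//.
    - by rewrite mulrC.
    - by rewrite nnegrE exprn_ge0// ltW.
    - by rewrite nnegrE ltW.
  have := geometric_sum_lt n rho1 (powR_ge0 t (p - 1)).
  by move=> /(ler_wpM2l (ltW t0))/le_trans; apply; rewrite -tp; lra.
apply: (@le_trans _ _ (2 * (t ^+ 2 * \sum_(j < n)
    (if sigma ^+ j <= t `^ (p - 2) then sigma ^+ j else 0)))).
  rewrite ler_pM2l// mulr_sumr; apply: ler_sum => j _.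
  have sj : 0 <= sigma ^+ j by rewrite exprn_ge0// powR_ge0.
  case: ifPn => [tl|_]; last by rewrite mulr_ge0 ?sqr_ge0//; case: ifP.
  suff -> : sigma ^+ j <= t `^ (p - 2) by rewrite mulrC.
  rewrite -lam_sigma -powR_exprn ?(ltW lam0)//.
  (* As [p - 2] is negative the power reverses the order; inversion returns to the positive exponent
     [2 - p]. *)
  rewrite -(opprB 2 p) !powRN lef_pV2 ?posrE ?powR_gt0 ?exprn_gt0//.
  by rewrite ge0_ler_powR ?subr_ge0 ?(ltW p2)// nnegrE ?exprn_ge0// ltW.
have := geometric_sum_le n sigma01 (powR_ge0 t (p - 2)).
move=> /(ler_wpM2l (sqr_ge0 t)) h; rewrite -tp2; nra.
Qed.

Let A0 : 0 <= A.
Proof. by rewrite fine_ge0// integral_ge0// => x _; rewrite lee_fin powR_ge0. Qed.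

Let AE : (\int[nu]_xi (u xi `^ alpha)%:E = A%:E)%E.
Proof.
rewrite /A fineK// ge0_fin_numE// integral_ge0// => x _.
by rewrite lee_fin powR_ge0.
Qed.

Let slice j := [set xi | 2^-1 ^+ j.+1 < u xi <= 2^-1 ^+ j].

Let measurable_slice j : measurable (slice j).
Proof.
rewrite -[slice j]setTI.
exact: (u_meas measurableT (measurable_itv `](2^-1 ^+ j.+1), (2^-1 ^+ j)]%R)).
Qed.

Let half_powR (q : R) j : (2^-1 ^+ j : R) `^ q = (2 `^ (- q)) ^+ j.
Proof. by rewrite powR_exprn// -powR_inv1// -powRrM mulN1r. Qed.

(** Chebyshev's inequality: on the slice [u ^ alpha] is at least [1 / kap ^+ j.+1]. *)
Let slice_le j : (nu (slice j) <= (A * kap ^+ j.+1)%:E)%E.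
Proof.
have k0 : 0 < kap ^+ j.+1 by rewrite exprn_gt0// powR_gt0.
rewrite mulrC EFinM -AE -lee_pdivrMl//.
rewrite -integral_scaled_indic ?invr_ge0 ?(ltW k0)//.
apply: ge0_le_integral => //.
- by move=> x _; rewrite lee_fin mulr_ge0// invr_ge0 ltW.
- exact: measurable_scaled_indic.
- by apply/measurable_EFinP; exact: (measurableT_comp (measurable_powR alpha)).
move=> xi _; rewrite lee_fin indicE; have [|_] := boolP (xi \in slice j).
  rewrite inE => /andP[ux _]; rewrite mulr1.
  have -> : (kap ^+ j.+1)^-1 = (2^-1 ^+ j.+1) `^ alpha.
    by rewrite half_powR powRN exprVn.
  have [u0 _] := andP (u01 xi).
  by rewrite ge0_ler_powR ?nnegrE ?(ltW ux) ?(ltW alpha0) ?exprn_ge0 ?(ltW u0).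
by rewrite mulr0 powR_ge0.
Qed.

Let large j (h : T1 -> R[i]) x := (\1_[set x | lam ^+ j < normc (h x)] x)%:C%C * h x.
Let small j (h : T1 -> R[i]) x := (\1_[set x | normc (h x) <= lam ^+ j] x)%:C%C * h x.

Let normc_large j h x :
  normc (large j h x) = if lam ^+ j < normc (h x) then normc (h x) else 0.
Proof.
rewrite /large Normc.normcM normc_real indicE normr_nat.
have [H|H] := boolP (lam ^+ j < _); first by rewrite mem_set// mul1r.
by rewrite memNset ?mul0r//=; exact/negP.
Qed.

Let normc_small j h x :
  normc (small j h x) = if normc (h x) <= lam ^+ j then normc (h x) else 0.
Proof.
rewrite /small Normc.normcM normc_real indicE normr_nat.
have [H|H] := boolP (_ <= lam ^+ j); first by rewrite mem_set// mul1r.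
by rewrite memNset ?mul0r//=; exact/negP.
Qed.

Let large_small j h x : large j h x + small j h x = h x.
Proof.
rewrite /large /small !indicE; have [H|H] := ltP (lam ^+ j) (normc (h x)).
  rewrite mem_set// memNset/= ?mul0r ?addr0 ?mul1r//.
  by apply/negP; rewrite -ltNge.
rewrite memNset ?mem_set//= ?mul0r ?add0r ?mul1r//.
by apply/negP; rewrite -leNgt.
Qed.

Let tame_large j h : tame mu h -> tame mu (large j h).
Proof.
move=> th; apply: tameM => //; last by move=> x; rewrite indicE normr_nat; case: (_ \in _).
apply: measurable_indic; rewrite -[X in measurable X]setTI.
have := measurable_normc th.1 measurableT (measurable_itv `](lam ^+ j), +oo[%R).
by congr measurable; congr setI; apply/seteqP; split => x /=; rewrite in_itv/= andbT.
Qed.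

Let tame_small j h : tame mu h -> tame mu (small j h).
Proof.
move=> th; apply: tameM => //; last by move=> x; rewrite indicE normr_nat; case: (_ \in _).
apply: measurable_indic; rewrite -[X in measurable X]setTI.
exact: (measurable_normc th.1 measurableT (measurable_itv `]-oo, (lam ^+ j)]%R)).
Qed.

Lemma weighted_interpolation : exists2 C : R, 0 <= C & forall h, tame mu h ->
  (\int[mu]_x (normc (h x) `^ p)%:E = 1)%E ->
  (\int[nu]_xi (u xi `^ s * normc (F h xi) ^+ 2)%:E <= C%:E)%E.
Proof.
have rho0 : 0 < rho by rewrite powR_gt0.
have lam0 : 0 < lam by rewrite powR_gt0.
have sig0 j : 0 <= sigma ^+ j by rewrite exprn_ge0// powR_ge0.
have C10 : 0 <= C1 by rewrite !mulr_ge0 ?powR_ge0.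
have C0 : 0 <= C.
  have [_ s1] := andP sigma01.
  apply: addr_ge0; last by rewrite divr_ge0// subr_ge0 ltW.
  by apply: mulr_ge0 => //; rewrite divr_ge0 ?subr_ge0 ?(ltW rho0) ?(ltW rho1).
exists C => // h th hp.
have mnormc k : tame mu k -> measurable_fun [set: T1] (fun x => normc (k x)).
  by move=> tk; exact: measurable_normc tk.1.
pose N j := fine (\int[mu]_x (normc (large j h x))%:E)%E.
have NE j : (\int[mu]_x (normc (large j h x))%:E = (N j)%:E)%E.
  have /inLp1_integrable ig := tame_inLp ltr01 (tame_large j th).
  by rewrite /N fineK// (integrable_fin_num _ ig).
have N0 j : 0 <= N j by rewrite fine_ge0// integral_ge0// => x _; rewrite lee_fin normc_ge0.
(* Where [|h| > lam ^+ j] one has [rho ^+ j <= |h| ^ (p - 1)], so the normalization of [h]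
   applies. *)
have Nle j : rho ^+ j * N j <= 1.
  rewrite -lee_fin EFinM -NE -hp -ge0_integralZl_EFin ?exprn_ge0 ?(ltW rho0)//.
  - apply: ge0_le_integral => //.
    + by move=> x _; rewrite -EFinM lee_fin mulr_ge0 ?normc_ge0 ?exprn_ge0 ?(ltW rho0).
    + apply/measurable_EFinP; apply: measurable_funM => //.
      exact: mnormc (tame_large j th).
    + apply/measurable_EFinP.
      by apply: (measurableT_comp (measurable_powR p)); exact: mnormc.
    + move=> x _; rewrite -EFinM lee_fin normc_large.
      case: ifPn => [lt|_]; last by rewrite mulr0 powR_ge0.
      have t0 : 0 < normc (h x) by rewrite (lt_trans _ lt)// exprn_gt0.
      rewrite -[p](subrK 1) powRD ?(gt_eqF t0) ?implybT// powRr1 ?(ltW t0)//.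
      rewrite ler_pM2r// -lam_rho -powR_exprn ?(ltW lam0)//.
      rewrite ge0_ler_powR ?nnegrE ?(ltW t0) ?(ltW lt) ?exprn_ge0 ?(ltW lam0)//.
      by rewrite subr_ge0; have [/ltW] := andP p12.
  - by move=> x _; rewrite lee_fin normc_ge0.
  - by apply/measurable_EFinP; exact: mnormc (tame_large j th).
(* Only the large part is restricted to the slice, where a sup bound needs finite measure. The small
   part is kept on the whole space so that [F_L2] applies. *)
pose G j xi : \bar R := ((2 * sigma ^+ j * (2 * N j) ^+ 2 * \1_(slice j) xi)%:E +
  (2 * sigma ^+ j)%:E * (normc (F (small j h) xi) ^+ 2)%:E)%E.
have c0 j : 0 <= 2 * sigma ^+ j * (2 * N j) ^+ 2 by rewrite !mulr_ge0 ?sqr_ge0.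
have mFs j : measurable_fun [set: T2] (fun xi => (normc (F (small j h) xi) ^+ 2)%:E).
  apply/measurable_EFinP; apply: measurable_funX; apply: measurable_normc.
  by apply: F_meas; exact: tame_small.
have G1 j xi : (0 <= (2 * sigma ^+ j * (2 * N j) ^+ 2 * \1_(slice j) xi)%:E)%E.
  by rewrite lee_fin mulr_ge0.
have G2 j xi : (0 <= (2 * sigma ^+ j)%:E * (normc (F (small j h) xi) ^+ 2)%:E)%E.
  by apply: mule_ge0; rewrite lee_fin ?sqr_ge0// mulr_ge0.
have G0 j xi : (0 <= G j xi)%E by rewrite adde_ge0.
have mG2 j : measurable_fun [set: T2]
    (fun xi => (2 * sigma ^+ j)%:E * (normc (F (small j h) xi) ^+ 2)%:E)%E.
  exact: emeasurable_funM.
have mG j : measurable_fun [set: T2] (G j).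
  by apply: emeasurable_funD => //; exact: measurable_scaled_indic.
(* The counterpart of [G j] on the side of [h], in the form summed by [pointwise]. *)
pose H j x : R := C1 * (if lam ^+ j < normc (h x) then rho ^+ j * normc (h x) else 0) +
  2 * (if normc (h x) <= lam ^+ j then sigma ^+ j * normc (h x) ^+ 2 else 0).
have HE j x : ((H j x)%:E = (C1 * rho ^+ j)%:E * (normc (large j h x))%:E +
    (2 * sigma ^+ j)%:E * (normc (small j h x) ^+ 2)%:E)%E.
  rewrite -!EFinM -EFinD normc_large normc_small /H; congr EFin; congr (_ + _).
    by case: ifP => _; rewrite ?mulr0 ?mulrA.
  by case: ifP => _; rewrite ?expr0n ?mulr0 ?mulrA.
have mH1 j : measurable_fun [set: T1]
    (fun x => (C1 * rho ^+ j)%:E * (normc (large j h x))%:E)%E.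
  apply: emeasurable_funM => //; apply/measurable_EFinP; exact: mnormc (tame_large j th).
have ms j : measurable_fun [set: T1] (fun x => (normc (small j h x) ^+ 2)%:E).
  by apply/measurable_EFinP; apply: measurable_funX; exact: mnormc (tame_small j th).
have mH2 j : measurable_fun [set: T1]
    (fun x => (2 * sigma ^+ j)%:E * (normc (small j h x) ^+ 2)%:E)%E.
  exact: emeasurable_funM.
have mH j : measurable_fun [set: T1] (fun x => (H j x)%:E).
  by under eq_fun do rewrite HE; exact: emeasurable_funD.
have H0 j x : (0 <= (H j x)%:E)%E.
  rewrite HE; apply: adde_ge0; apply: mule_ge0; rewrite lee_fin ?sqr_ge0 ?normc_ge0//.
    by rewrite mulr_ge0// exprn_ge0// ltW.
  by rewrite mulr_ge0.
have GH j : (\int[nu]_xi G j xi <= \int[mu]_x (H j x)%:E)%E.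
  rewrite ge0_integralD//; last exact: measurable_scaled_indic.
  rewrite integral_scaled_indic// ge0_integralZl_EFin ?mulr_ge0//; last first.
    by move=> x _; rewrite lee_fin sqr_ge0.
  rewrite F_L2; last exact: tame_small.
  under [leRHS]eq_integral do rewrite HE.
  rewrite ge0_integralD//; last 2 first.
  - move=> x _; apply: mule_ge0; rewrite lee_fin ?normc_ge0//.
    by rewrite mulr_ge0// exprn_ge0// ltW.
  - by move=> x _; apply: mule_ge0; rewrite lee_fin ?sqr_ge0// mulr_ge0.
  rewrite [X in (_ <= _ + X)%E]ge0_integralZl_EFin ?mulr_ge0//; last first.
    by move=> x _; rewrite lee_fin sqr_ge0.
  have C1rho : 0 <= C1 * rho ^+ j by rewrite mulr_ge0// exprn_ge0// ltW.
  rewrite leeD2r// ge0_integralZl_EFin//; last 2 first.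
  - by move=> x _; rewrite lee_fin normc_ge0.
  - by apply/measurable_EFinP; exact: mnormc (tame_large j th).
  rewrite NE; apply: le_trans (lee_wpmul2l _ (slice_le j)) _; first by rewrite lee_fin.
  rewrite -!EFinM lee_fin.
  (* By [sigma_kap] each [N j] receives one factor [rho ^+ j]. Then [Nle] discards one of the two
     products, leaving a bound linear in [N j], hence an integral of the large part. *)
  have -> : 2 * sigma ^+ j * (2 * N j) ^+ 2 * (A * kap ^+ j.+1) =
     C1 * (rho ^+ j * N j) * (rho ^+ j * N j).
    rewrite /C1 (exprS kap).
    have sk : sigma ^+ j * kap ^+ j = rho ^+ j * rho ^+ j.
      by rewrite -exprMn sigma_kap -exprM mulnC exprM -expr2.
    transitivity (8 * A * kap * N j ^+ 2 * (sigma ^+ j * kap ^+ j)); first by ring.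
    by rewrite sk; ring.
  rewrite -[leRHS]mulrA; apply: ler_piMr => //.
  by rewrite mulr_ge0// mulr_ge0// exprn_ge0// ltW.
apply: (@le_trans _ _ (\int[nu]_xi \sum_(0 <= j <oo) G j xi)%E).
  apply: ge0_le_integral => //.
  - by move=> xi _; rewrite lee_fin mulr_ge0 ?powR_ge0 ?sqr_ge0.
  - apply/measurable_EFinP; apply: measurable_funM.
      exact: (measurableT_comp (measurable_powR s)).
    by apply: measurable_funX; apply: measurable_normc; exact: F_meas.
  - exact: ge0_emeasurable_sum.
  move=> xi _; have [j uj] := dyadic_between (u01 xi).
  apply: (@le_trans _ _ (G j xi)); last first.
    (* The partial sum must have [j.+1] terms to contain the one of index [j]. *)
    apply: le_trans (nneseries_lim_ge j.+1 _); last by [].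
    by rewrite big_nat_recr//= leeDr// sume_ge0.
  rewrite /G -EFinM -EFinD lee_fin indicE mem_set// mulr1.
  have [u0 _] := andP (u01 xi); have [_ uj2] := andP uj.
  have us : u xi `^ s <= sigma ^+ j.
    by rewrite -half_powR ge0_ler_powR ?nnegrE ?(ltW s0) ?(ltW u0) ?exprn_ge0.
  have FaN : normc (F (large j h) xi) <= 2 * N j.
    by rewrite -lee_fin EFinM -NE F_sup//; exact: tame_large.
  have Fab : normc (F h xi) <= 2 * N j + normc (F (small j h) xi).
    have -> : F h xi = F (large j h) xi + F (small j h) xi.
      rewrite -F_add; [|exact: tame_large|exact: tame_small].
      by congr (F _ xi); apply/funext => x; rewrite large_small.
    by apply: le_trans (normc_triangle _ _) _; rewrite lerD2r.
  apply: (@le_trans _ _ (sigma ^+ j * (2 * N j + normc (F (small j h) xi)) ^+ 2)).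
    rewrite ler_pM ?powR_ge0 ?sqr_ge0// lerXn2r ?nnegrE ?normc_ge0//.
    by rewrite addr_ge0 ?normc_ge0 ?mulr_ge0.
  set y := normc (F (small j h) xi); set z := 2 * N j; rewrite -subr_ge0.
  (* This is [2 z^2 + 2 y^2 - (z + y)^2 = (z - y)^2]. *)
  rewrite (_ : _ - _ = sigma ^+ j * (z - y) ^+ 2); last by ring.
  by rewrite mulr_ge0 ?sqr_ge0.
rewrite integral_nneseries//.
apply: (@le_trans _ _ (\sum_(0 <= j <oo) \int[mu]_x (H j x)%:E)%E).
  by apply: lee_nneseries => // j _; rewrite integral_ge0.
rewrite -integral_nneseries//.
apply: (@le_trans _ _ (\int[mu]_x (C%:E * (normc (h x) `^ p)%:E))%E); last first.
  rewrite ge0_integralZl_EFin// ?hp ?mule1//.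
  - by move=> x _; rewrite lee_fin powR_ge0.
  - apply/measurable_EFinP.
    by apply: (measurableT_comp (measurable_powR p)); exact: mnormc.
apply: ge0_le_integral => //.
- by move=> x _; apply: nneseries_ge0.
- exact: ge0_emeasurable_sum.
- apply: emeasurable_funM => //; apply/measurable_EFinP.
  by apply: (measurableT_comp (measurable_powR p)); exact: mnormc.
move=> x _; apply: lime_le; first exact: is_cvg_nneseries.
apply: nearW => n; rewrite sumEFin -EFinM lee_fin big_mkord.
exact: pointwise (normc_ge0 _).
Qed.

End Interpolation.

(** * Duality and the Plancherel pairing *)

Section DualEstimate.
Context (R : realType) d (T : measurableType d) (mu : {measure set T -> \bar R}).

(** The converse of Hölder's inequality, tested only on nonnegative multiples of [f]. The relation
    [p * (q - 1) = q] says that [p] and [q] are conjugate. *)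
Lemma dual_estimate (f : T -> R[i]) (p q K : R) :
  inLp mu 2 f -> 0 < p -> 2 <= q -> p * (q - 1) = q -> 0 <= K ->
  (forall phi : T -> R, measurable_fun [set: T] phi -> (forall x, 0 <= phi x) ->
    let h x := (phi x)%:C%C * f x in
    tame mu h -> (\int[mu]_x (normc (h x) `^ p)%:E = 1)%E ->
    (\int[mu]_x (normc (f x) * normc (h x))%:E <= K%:E)%E) ->
  (\int[mu]_x (normc (f x) `^ q)%:E <= (K `^ q)%:E)%E.
Proof.
move=> f2 p0 q2 pq K0 fK; have mf : cmeasurable f by case: f2.
have q0 : 0 < q by rewrite (lt_le_trans _ q2).
have mnf := measurable_normc mf.
have mpow r : measurable_fun [set: T] (fun x => normc (f x) `^ r).
  exact: (measurableT_comp (measurable_powR r)).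
have mI n : measurable_fun [set: T] (fun x => normc (f x) `^ q * \1_(level f n) x).
  by apply: measurable_funM => //; apply: measurable_indic; exact: measurable_level.
have I0 n x : 0 <= normc (f x) `^ q * \1_(level f n) x.
  by rewrite mulr_ge0// powR_ge0.
(* Monotone convergence along the levels; zeros of [f] contribute nothing as [q > 0]. *)
suff In n : (\int[mu]_x (normc (f x) `^ q * \1_(level f n) x)%:E <= (K `^ q)%:E)%E.
  rewrite (_ : (\int[mu]_x (normc (f x) `^ q)%:E)%E = limn (fun n =>
      \int[mu]_x (normc (f x) `^ q * \1_(level f n) x)%:E)%E); last first.
    rewrite -monotone_convergence//.
    - apply: eq_integral => x _; apply/esym/cvg_lim => //.
      apply: cvg_near_cst; have [fx0|fx0] := eqVneq (f x) 0.
        apply: nearW => n.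
        by rewrite fx0 Normc.normc0 powR0 ?mul0r// gt_eqF.
      by apply: filterS (level_near fx0) => n xn; rewrite indicE mem_set// mulr1.
    - by move=> n; apply/measurable_EFinP.
    - by move=> n x _; rewrite lee_fin.
    - move=> x _ m n mn; rewrite lee_fin ler_wpM2l ?powR_ge0// !indicE ler_nat.
      have [|_] := boolP (x \in level f m); last by case: (_ \in _).
      rewrite inE => xm; rewrite mem_set//.
      by have /subsetPset := nondecreasing_level f mn; exact.
  apply: lime_le; last exact: nearW.
  apply: ereal_nondecreasing_is_cvgn => m n mn; apply: ge0_le_integral => //.
  - by move=> x _; rewrite lee_fin.
  - exact/measurable_EFinP.
  - exact/measurable_EFinP.
  move=> x _; rewrite lee_fin ler_wpM2l ?powR_ge0// !indicE ler_nat.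
  have [|_] := boolP (x \in level f m); last by case: (_ \in _).
  rewrite inE => xm; rewrite mem_set//.
  by have /subsetPset := nondecreasing_level f mn; exact.
have mL := measurable_level n mf.
have Lb x : x \in level f n -> 0 < normc (f x) <= n.+1%:R.
  rewrite inE => /andP[h1 ->]; rewrite andbT; apply: lt_le_trans h1.
  by rewrite invr_gt0.
(* Finiteness permits normalizing by a power of the integral: [|f|] is bounded on the level, whose
   measure is finite because [f] is in [L^2]. *)
have Ifin : (\int[mu]_x (normc (f x) `^ q * \1_(level f n) x)%:E < +oo)%E.
  apply: (@le_lt_trans _ _ (\int[mu]_x (n.+1%:R `^ q * \1_(level f n) x)%:E)%E).
    apply: ge0_le_integral => //.
    - by move=> x _; rewrite lee_fin.
    - exact/measurable_EFinP.
    - exact: measurable_scaled_indic.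
    move=> x _; rewrite lee_fin indicE; have [/Lb /andP[f0 fn]|_] := boolP (_ \in _).
      by rewrite !mulr1 ge0_ler_powR// ?nnegrE// ltW.
    by rewrite !mulr0.
  rewrite integral_scaled_indic ?powR_ge0// lte_mul_pinfty ?lee_fin ?powR_ge0//.
  by apply: level_lty f2.
have : (0 <= \int[mu]_x (normc (f x) `^ q * \1_(level f n) x)%:E)%E.
  by apply: integral_ge0 => x _; rewrite lee_fin.
case IE : (\int[mu]_x (normc (f x) `^ q * \1_(level f n) x)%:E)%E Ifin => [I||]// _.
rewrite lee_fin le_eqVlt => /predU1P[<-|Ipos]; first by rewrite lee_fin powR_ge0.
(* Since [|f| ^ (p * (q - 1)) = |f| ^ q], this [c] gives the test function [p]-th power integral 1.
   The pairing with [f] is then [c * I], which equals [I ^ (1 / q)]. *)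
pose c := I `^ (- p^-1).
have c0 : 0 < c by rewrite powR_gt0.
pose phi x := c * (normc (f x) `^ (q - 2) * \1_(level f n) x).
have phi0 x : 0 <= phi x by rewrite !mulr_ge0 ?(ltW c0) ?powR_ge0.
have mphi : measurable_fun [set: T] phi.
  apply: measurable_funM; first exact: measurable_cst.
  by apply: measurable_funM; [exact: mpow|exact: measurable_indic].
have hE x : normc ((phi x)%:C%C * f x) =
    c * (normc (f x) `^ (q - 1) * \1_(level f n) x).
  rewrite Normc.normcM normc_real (ger0_norm (phi0 x)) /phi -mulrA; congr (_ * _).
  rewrite indicE; have [/Lb /andP[f0 _]|_] := boolP (_ \in _); last by rewrite !mulr0 mul0r.
  rewrite !mulr1 -{2}[normc (f x)]powRr1 ?(ltW f0)// -powRD ?(gt_eqF f0) ?implybT//.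
  by congr (_ `^ _); lra.
have th : tame mu (fun x => (phi x)%:C%C * f x).
  split; first exact: cmeasurableM (cmeasurable_real mphi) mf.
  exists (c * n.+1%:R `^ (q - 1)), (level f n); split => //.
  - by rewrite mulr_ge0 ?powR_ge0.
  - by apply: level_lty f2.
  move=> x; rewrite hE -mulrA ler_wpM2l ?(ltW c0)//.
  rewrite !indicE; have [/Lb /andP[f0 fn]|_] := boolP (_ \in _); last by rewrite !mulr0.
  by rewrite !mulr1 ge0_ler_powR ?nnegrE ?(ltW f0)//; lra.
have hp : (\int[mu]_x (normc ((phi x)%:C%C * f x) `^ p)%:E = 1)%E.
  have hpE x : normc ((phi x)%:C%C * f x) `^ p =
      I^-1 * (normc (f x) `^ q * \1_(level f n) x).
    rewrite hE powRM ?mulr_ge0 ?powR_ge0 ?(ltW c0)// /c -powRrM mulNr mulVf ?gt_eqF//.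
    rewrite powRN powRr1 ?(ltW Ipos)//; congr (_ * _).
    rewrite indicE; have [_|_] := boolP (_ \in _); last by rewrite !mulr0 powR0// gt_eqF.
    by rewrite !mulr1 -powRrM mulrC pq.
  under eq_integral do rewrite hpE EFinM.
  rewrite ge0_integralZl_EFin// ?invr_ge0 ?(ltW Ipos)//; last 2 first.
  - by move=> x _; rewrite lee_fin.
  - exact/measurable_EFinP.
  by rewrite IE -EFinM mulVf// gt_eqF.
have := fK phi mphi phi0 th hp.
have fhE x : normc (f x) * normc ((phi x)%:C%C * f x) =
    c * (normc (f x) `^ q * \1_(level f n) x).
  rewrite hE mulrCA; congr (_ * _).
  rewrite !indicE; have [/Lb /andP[f0 _]|_] := boolP (_ \in _); last by rewrite !mulr0.
  rewrite !mulr1 -{1}[normc (f x)]powRr1 ?(ltW f0)// -powRD ?(gt_eqF f0) ?implybT//.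
  by congr (_ `^ _); lra.
under eq_integral do rewrite fhE EFinM.
rewrite ge0_integralZl_EFin// ?(ltW c0)//; last 2 first.
- by move=> x _; rewrite lee_fin.
- exact/measurable_EFinP.
rewrite IE -EFinM !lee_fin => cIK.
have -> : I = (c * I) `^ q.
  rewrite /c -{3}[I]powRr1 ?(ltW Ipos)// -powRD ?(gt_eqF Ipos) ?implybT//.
  rewrite -powRrM (_ : _ * q = 1) ?powRr1 ?(ltW Ipos)//.
  have : p^-1 = (q - 1) / q by rewrite -{2}pq; field; rewrite !gt_eqF//; lra.
  by move=> ->; field; rewrite gt_eqF.
by rewrite ge0_ler_powR ?nnegrE ?(ltW q0)// mulr_ge0 ?(ltW c0) ?(ltW Ipos).
Qed.

End DualEstimate.

(** Hölder's inequality with exponents 2 and 2 for [w ^ (1/2) * a] and [w ^ (- 1/2) * b]. *)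
Lemma weighted_cauchy_schwarz (R : realType) d (T : measurableType d)
    (nu : {measure set T -> \bar R}) (w a b : T -> R) :
  measurable_fun [set: T] w -> measurable_fun [set: T] a ->
  measurable_fun [set: T] b ->
  (forall x, 0 < w x) -> (forall x, 0 <= a x) -> (forall x, 0 <= b x) ->
  (\int[nu]_x (a x * b x)%:E <=
   (\int[nu]_x (w x * a x ^+ 2)%:E) `^ 2^-1 *
   (\int[nu]_x ((w x)^-1 * b x ^+ 2)%:E) `^ 2^-1)%E.
Proof.
move=> mw ma mb w0 a0 b0.
pose f x := w x `^ 2^-1 * a x; pose g x := w x `^ (- 2^-1) * b x.
have mf : measurable_fun [set: T] f.
  by apply: measurable_funM => //; exact: (measurableT_comp (measurable_powR _)).
have mg : measurable_fun [set: T] g.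
  by apply: measurable_funM => //; exact: (measurableT_comp (measurable_powR _)).
have f0 x : 0 <= f x by rewrite mulr_ge0 ?powR_ge0.
have g0 x : 0 <= g x by rewrite mulr_ge0 ?powR_ge0.
have half (r : R) : 0 < r -> (r `^ 2^-1) ^+ 2 = r.
  by move=> r0; rewrite powR12_sqrt ?sqr_sqrtr ?(ltW r0).
have N1 : Lnorm nu 1 (EFin \o (f \* g)) = (\int[nu]_x (a x * b x)%:E)%E.
  rewrite Lnorm1; apply: eq_integral => x _.
  rewrite /= (ger0_norm (mulr_ge0 (f0 x) (g0 x))) /f /g mulrACA.
  by rewrite -powRD ?(gt_eqF (w0 x)) ?implybT// subrr powRr0 mul1r.
have N2 (k : T -> R) : (forall x, 0 <= k x) ->
    Lnorm nu 2%:E (EFin \o k) = ((\int[nu]_x (k x ^+ 2)%:E) `^ 2^-1)%E.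
  move=> k0; rewrite unlock; congr (_ `^ _)%E; apply: eq_integral => x _.
  by rewrite /= ger0_norm// powR_mulrn.
have := hoelder nu mf mg (ltr0Sn _ 1) (ltr0Sn _ 1).
rewrite (_ : 2^-1 + 2^-1 = 1); last by lra.
move=> /(_ erefl); rewrite N1 !N2//.
under [in X in (_ <= X * _)%E]eq_integral do rewrite exprMn half//.
under [in X in (_ <= _ * X)%E]eq_integral do rewrite exprMn powRN exprVn half//.
by [].
Qed.

(** Nonnegativity lets the square be expanded in the extended reals, with infinite terms allowed. *)
Lemma ge0_integral_sqrD (R : realType) d (T : measurableType d)
    (nu : {measure set T -> \bar R}) (a b : T -> R) :
  measurable_fun [set: T] a -> measurable_fun [set: T] b ->
  (forall x, 0 <= a x) -> (forall x, 0 <= b x) ->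
  (\int[nu]_x ((a x + b x) ^+ 2)%:E = \int[nu]_x (a x ^+ 2)%:E +
    \int[nu]_x (b x ^+ 2)%:E + 2%:E * \int[nu]_x (a x * b x)%:E)%E.
Proof.
move=> ma mb a0 b0.
have mab : measurable_fun [set: T] (fun x => (a x * b x)%:E).
  by apply/measurable_EFinP; exact: measurable_funM.
have ma2 : measurable_fun [set: T] (fun x => (a x ^+ 2)%:E).
  by apply/measurable_EFinP; exact: measurable_funX.
have mb2 : measurable_fun [set: T] (fun x => (b x ^+ 2)%:E).
  by apply/measurable_EFinP; exact: measurable_funX.
have ab0 x : [set: T] x -> (0 <= (a x * b x)%:E)%E by rewrite lee_fin mulr_ge0.
have a20 x : [set: T] x -> (0 <= (a x ^+ 2)%:E)%E by rewrite lee_fin sqr_ge0.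
have b20 x : [set: T] x -> (0 <= (b x ^+ 2)%:E)%E by rewrite lee_fin sqr_ge0.
rewrite -(ge0_integralZl_EFin nu measurableT ab0 mab)//.
rewrite -(ge0_integralD nu measurableT a20 ma2 b20 mb2).
rewrite -ge0_integralD//; last 4 first.
- by move=> x _; rewrite adde_ge0 ?a20 ?b20.
- exact: emeasurable_funD.
- by move=> x _; rewrite mule_ge0 ?ab0.
- exact: emeasurable_funM.
apply: eq_integral => x _; rewrite -EFinM -!EFinD; congr EFin; ring.
Qed.

(** * Plancherel transforms and the pairing inequality *)

Section Plancherel.
Variables (R : realType) (G : topologicalZmodType).
Variables (mu : {measure set (borelG G) -> \bar R})
          (nu : {measure set (dualB R G) -> \bar R}).
Hypotheses (hG : hausdorff_space G) (muH : haar_G mu).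
Hypothesis plan : plancherel_normalized mu nu.
Implicit Types (f h : G -> R[i]) (g : dual R G -> R[i]).

Lemma inLp_fourier f : @inLp R _ (borelG G) mu 1 f -> @inLp R _ (borelG G) mu 2 f ->
  @inLp R _ (dualB R G) nu 2 (fourier mu f).
Proof.
move=> f1 f2; split; first exact: cmeasurable_fourier.
by rewrite plan//; case: f2.
Qed.

(** The approximants have equal norms on both sides by Plancherel, and these norms converge to those
    of [f] and of [g]. *)
Lemma plancherel_transform_norm f g : @inLp R _ (borelG G) mu 2 f ->
  is_plancherel_transform mu nu f g -> cLnorm nu 2 g = cLnorm mu 2 f.
Proof.
move=> [mf foo] [[mg goo] [F [F12 Ff Fg]]].
have n12 : (1 : R) <= 2 by rewrite ler1n.
have F1 n := (F12 n).1; have F2 n := (F12 n).2.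
have cf : cLnorm mu 2 (F n) @[n --> \oo] --> cLnorm mu 2 f.
  by apply: cvg_cLnorm => // n; case: (F2 n).
have cg : cLnorm nu 2 (fourier mu (F n)) @[n --> \oo] --> cLnorm nu 2 g.
  by apply: cvg_cLnorm => // n; case: (inLp_fourier (F1 n) (F2 n)).
have cfg : cLnorm nu 2 (fourier mu (F n)) @[n --> \oo] --> cLnorm mu 2 f.
  by under eq_cvg do rewrite plan//.
exact: (cvg_unique _ cg cfg).
Qed.

(** Adding [h] to every approximant of [f] leaves both error terms unchanged. *)
Lemma plancherel_transformD f g h : is_plancherel_transform mu nu f g ->
  @tame R _ (borelG G) mu h ->
  is_plancherel_transform mu nu (fun x => f x + h x) (fun xi => g xi + fourier mu h xi).
Proof.
move=> [g2 [F [F12 Ff Fg]]] th.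
have h1 : @inLp R _ (borelG G) mu 1 h by exact: tame_inLp.
have h2 : @inLp R _ (borelG G) mu 2 h by exact: tame_inLp.
have n12 : (1 : R) <= 2 by rewrite ler1n.
split; first by apply: inLpD => //; exact: inLp_fourier.
exists (fun n x => F n x + h x); split.
- by move=> n; have [? ?] := F12 n; split; apply: inLpD.
- rewrite (_ : (fun n => _) = (fun n => cLnorm mu 2 (fun x => F n x - f x)))//.
  by apply/funext => n; congr cLnorm; apply/funext => x; rewrite opprD addrACA subrr addr0.
- rewrite (_ : (fun n => _) = (fun n => cLnorm nu 2 (fun xi => fourier mu (F n) xi - g xi)))//.
  apply/funext => n; congr cLnorm; apply/funext => x.
  by rewrite fourierD ?opprD 1?addrACA ?subrr ?addr0//; case: (F12 n).
Qed.

(** As [h] has the phase of [f], [|f + h| = |f| + |h|], whereas on the dual side only the triangle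
    inequality holds. Expanding both squares and cancelling the equal norms leaves the cross
    terms. *)
Lemma plancherel_pairing f g (phi : G -> R) : @inLp R _ (borelG G) mu 2 f ->
  is_plancherel_transform mu nu f g -> (forall x, 0 <= phi x) ->
  let h x := (phi x)%:C%C * f x in @tame R _ (borelG G) mu h ->
  (\int[mu]_x (normc (f x) * normc (h x))%:E <=
   \int[nu]_xi (normc (g xi) * normc (fourier mu h xi))%:E)%E.
Proof.
move=> f2 fg phi0 h th.
have h1 : @inLp R _ (borelG G) mu 1 h by exact: tame_inLp.
have h2 : @inLp R _ (borelG G) mu 2 h by exact: tame_inLp.
have [g2 _] := fg; have Fh2 := inLp_fourier h1 h2.
have n12 : (1 : R) <= 2 by rewrite ler1n.
have fhP := plancherel_transformD fg th.
have fh2 : @inLp R _ (borelG G) mu 2 (fun x => f x + h x) by exact: inLpD.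
have sqE (x y : \bar R) : x = y -> (x `^ 2 = y `^ 2)%E by move=> ->.
have := sqE _ _ (plancherel_transform_norm f2 fg); rewrite !cLnorm2_sqr => gf.
have := sqE _ _ (plan h1 h2); rewrite !cLnorm2_sqr => Fhh.
have := sqE _ _ (plancherel_transform_norm fh2 fhP); rewrite !cLnorm2_sqr => gfh.
have mn (k : G -> R[i]) : @inLp R _ (borelG G) mu 2 k ->
    measurable_fun [set: borelG G] (fun x => normc (k x)).
  by case=> mk _; exact: measurable_normc.
have mn' (k : dual R G -> R[i]) : @inLp R _ (dualB R G) nu 2 k ->
    measurable_fun [set: dualB R G] (fun x => normc (k x)).
  by case=> mk _; exact: measurable_normc.
have fin (k : G -> R[i]) : @inLp R _ (borelG G) mu 2 k ->
    (\int[mu]_x (normc (k x) ^+ 2)%:E \is a fin_num)%E.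
  move=> [_ koo]; rewrite -cLnorm2_sqr ge0_fin_numE ?poweR_ge0//.
  exact: poweR_lty.
have lhs : (\int[mu]_x (normc (f x + h x) ^+ 2)%:E =
   \int[mu]_x ((normc (f x) + normc (h x)) ^+ 2)%:E)%E.
  apply: eq_integral => x _; congr (EFin (_ ^+ 2)).
  rewrite /h -{1}[f x]mul1r -mulrDl !Normc.normcM normc_real (ger0_norm (phi0 x)).
  rewrite (_ : 1 + _ = (1 + phi x)%:C%C); last by rewrite rmorphD.
  by rewrite normc_real ger0_norm ?addr_ge0// mulrDl mul1r.
have rhs : (\int[nu]_xi (normc (g xi + fourier mu h xi) ^+ 2)%:E <=
   \int[nu]_xi ((normc (g xi) + normc (fourier mu h xi)) ^+ 2)%:E)%E.
  apply: ge0_le_integral => //.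
  - by move=> xi _; rewrite lee_fin sqr_ge0.
  - by apply/measurable_EFinP; apply: measurable_funX; apply: mn'; exact: inLpD.
  - by apply/measurable_EFinP; apply: measurable_funX; apply: measurable_funD; exact: mn'.
  - move=> xi _; rewrite lee_fin lerXn2r ?nnegrE ?addr_ge0 ?normc_ge0//.
    exact: normc_triangle.
move: rhs; rewrite gfh lhs.
rewrite (ge0_integral_sqrD mu (mn _ f2) (mn _ h2)); try by move=> x; exact: normc_ge0.
rewrite (ge0_integral_sqrD nu (mn' _ g2) (mn' _ Fh2)); try by move=> x; exact: normc_ge0.
(* Cancellation in the extended reals is legitimate because [f] and [h] have finite [L^2] norm. *)
rewrite gf Fhh leeD2lE; last by rewrite fin_numD (fin _ f2) (fin _ h2).
by rewrite lee_pmul2l.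
Qed.

End Plancherel.

(** * The weighted bound for the Fourier transform, and the embedding *)

Lemma weighted_fourier_bound (R : realType) (G : topologicalZmodType)
    (mu : {measure set (borelG G) -> \bar R})
    (nu : {measure set (dualB R G) -> \bar R}) (u : dualB R G -> R) (s alpha : R) :
  hausdorff_space G -> haar_G mu -> plancherel_normalized mu nu ->
  measurable_fun [set: dualB R G] u -> (forall xi, 0 < u xi <= 1) ->
  (\int[nu]_xi (u xi `^ alpha)%:E < +oo)%E -> 0 <= s -> s < alpha ->
  exists2 C : R, 0 <= C & forall h : borelG G -> R[i], tame mu h ->
    (\int[mu]_x (normc (h x) `^ (2 * alpha / (alpha + s)))%:E = 1)%E ->
    (\int[nu]_xi (u xi `^ s * normc (fourier mu h xi) ^+ 2)%:E <= C%:E)%E.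
Proof.
move=> hG muH plan u_meas u01 u_int s_ge0 s_alpha.
have F_L2 (h : borelG G -> R[i]) : tame mu h ->
    (\int[nu]_xi (normc (fourier mu h xi) ^+ 2)%:E =
     \int[mu]_x (normc (h x) ^+ 2)%:E)%E.
  move=> th; have h1 : inLp mu 1 h by exact: tame_inLp.
  have h2 : inLp mu 2 h by exact: tame_inLp.
  by rewrite -!cLnorm2_sqr plan.
move: s_ge0; rewrite le_eqVlt => /predU1P[s0|s0]; last first.
  apply: (@weighted_interpolation _ _ _ _ _ mu nu (fourier mu)) => //.
  - by move=> h th; exact: cmeasurable_fourier_tame.
  - by move=> h k xi th tk; apply: fourierD; exact: tame_inLp.
  - by move=> h xi th; apply: normc_fourier_le; exact: tame_inLp.
(* For [s = 0] the ratio [sigma] would be 1 and its series would diverge. But then the exponent is 2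
   and the weight is 1, so Plancherel gives the bound with constant 1. *)
exists 1 => // h th; rewrite -s0 addr0 => hp.
under eq_integral do rewrite powRr0 mul1r.
rewrite F_L2// -hp -s0 in s_alpha *.
rewrite le_eqVlt; apply/orP; left; apply/eqP; apply: eq_integral => x _.
by rewrite mulfK ?gt_eqF// powR_mulrn// normc_ge0.
Qed.

Theorem theorem3 (R : realType) (G : topologicalZmodType)
    (mu : {measure set (borelG G) -> \bar R})
    (nu : {measure set (dualB R G) -> \bar R})
    (gamma : dual R G -> R) (s alpha : R) :
  hausdorff_space G -> locally_compact [set: G] ->
  haar_G mu -> haar_dual nu -> plancherel_normalized mu nu ->
  in_Gamma gamma -> 0 <= s -> s < alpha ->
  inLp_real nu alpha (fun xi : dualB R G => (1 + gamma xi ^+ 2)^-1) ->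
  let alpha_star := 2 * alpha / (alpha - s) in
  exists D : R, forall (f : G -> R[i]) (g : dual R G -> R[i]),
    inLp mu 2 f -> is_plancherel_transform mu nu f g ->
    (Hs_norm nu gamma s g < +oo)%E ->
    inLp mu alpha_star f /\
    (cLnorm mu alpha_star f <= D%:E * Hs_norm nu gamma s g)%E.
Proof.
move=> hG _ muH _ plan _ s0 s_alpha [u_meas u_fin] alpha_star.
pose u (xi : dualB R G) := (1 + gamma xi ^+ 2)^-1.
have alpha0 : 0 < alpha by exact: le_lt_trans s0 s_alpha.
have g1 (xi : dual R G) : 1 <= 1 + gamma xi ^+ 2 by rewrite lerDl sqr_ge0.
have g0 (xi : dual R G) : 0 < 1 + gamma xi ^+ 2 by rewrite (lt_le_trans _ (g1 xi)).
have u01 xi : 0 < u xi <= 1 by rewrite /u invr_gt0 g0 invf_le1 ?g1 ?g0.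
have u_int : (\int[nu]_xi (u xi `^ alpha)%:E < +oo)%E.
  have := poweR_lty alpha u_fin; rewrite poweR_Lnorm ?gt_eqF//.
  under eq_integral => xi _.
    rewrite abse_EFin poweR_EFin ger0_norm; first over.
    by have [/ltW] := andP (u01 xi).
  by [].
have [C C0 FC] := weighted_fourier_bound hG muH plan u_meas u01 u_int s0 s_alpha.
(* The square root comes from Cauchy-Schwarz, where [C] bounds the squared weighted norm of the
   transform of the test function. *)
exists (C `^ 2^-1) => f g f2 fg Hs_fin.
set H := Hs_norm nu gamma s g in Hs_fin *.
have Hfin : H \is a fin_num by rewrite ge0_fin_numE// poweR_ge0.
pose K := C `^ 2^-1 * fine H.
have K0 : 0 <= K by rewrite mulr_ge0 ?powR_ge0// fine_ge0// poweR_ge0.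
have q2 : 2 <= alpha_star by rewrite ler_pdivlMr ?subr_gt0//; lra.
have q0 : 0 < alpha_star by rewrite (lt_le_trans _ q2).
have as0 : 0 < alpha + s by rewrite ltr_wpDr.
pose p := 2 * alpha / (alpha + s).
have p0 : 0 < p by rewrite divr_gt0// mulr_gt0.
have pq : p * (alpha_star - 1) = alpha_star.
  by rewrite /p /alpha_star; field; rewrite subr_eq0 (gt_eqF s_alpha) (gt_eqF as0).
have fK : (\int[mu]_x (normc (f x) `^ alpha_star)%:E <= (K `^ alpha_star)%:E)%E.
  apply: (dual_estimate f2 p0 q2 pq K0) => phi mphi phi0 h th hp.
  apply: le_trans (plancherel_pairing hG muH plan f2 fg phi0 th) _.
  have mw : measurable_fun [set: dualB R G] (fun xi => u xi `^ (- s)).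
    exact: (measurableT_comp (measurable_powR _)).
  have w0 xi : 0 < u xi `^ (- s) by rewrite powR_gt0//; case/andP: (u01 xi).
  have mg : measurable_fun [set: dualB R G] (fun xi => normc (g xi)).
    by apply: measurable_normc; case: fg => -[].
  have mFh : measurable_fun [set: dualB R G] (fun xi => normc (fourier mu h xi)).
    by apply: measurable_normc; exact: cmeasurable_fourier_tame.
  (* The weight [u ^ (- s)] equals [(1 + gamma^2) ^ s]: the first factor becomes the Sobolev norm,
     and the second carries [u ^ s], as [FC] requires. *)
  have := weighted_cauchy_schwarz nu mw mg mFh w0
    (fun _ => normc_ge0 _) (fun _ => normc_ge0 _).
  move=> /le_trans; apply.
  have -> : ((\int[nu]_xi (u xi `^ (- s) * normc (g xi) ^+ 2)%:E) `^ 2^-1 = H)%E.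
    congr (_ `^ _)%E; apply: eq_integral => xi _; congr (EFin (_ * _)).
    by rewrite /u -powR_inv1 ?(ltW (g0 xi))// -powRrM mulN1r opprK.
  rewrite /K EFinM fineK// muleC lee_wpmul2r ?poweR_ge0// -poweR_EFin.
  apply: gt0_ler_poweR; first by rewrite invr_ge0.
  - rewrite in_itv/= leey andbT integral_ge0// => xi _.
    by rewrite lee_fin mulr_ge0 ?sqr_ge0// invr_ge0 ltW.
  - by rewrite in_itv/= leey andbT lee_fin.
  have <- : (\int[nu]_xi (u xi `^ s * normc (fourier mu h xi) ^+ 2)%:E =
      \int[nu]_xi ((u xi `^ (- s))^-1 * normc (fourier mu h xi) ^+ 2)%:E)%E.
    by apply: eq_integral => xi _; rewrite -powRN opprK.
  exact: FC.
have fle : (cLnorm mu alpha_star f <= (C `^ 2^-1)%:E * H)%E.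
  rewrite cLnormE ?gt_eqF//.
  have -> : ((C `^ 2^-1)%:E * H = K%:E)%E by rewrite /K EFinM fineK.
  have -> : K%:E = ((K `^ alpha_star)%:E `^ alpha_star^-1)%E.
    by rewrite poweR_EFin -powRrM mulfV ?gt_eqF// powRr1.
  apply: gt0_ler_poweR fK; first by rewrite invr_ge0 ltW.
  - by rewrite in_itv/= leey andbT integral_ge0// => x _; rewrite lee_fin powR_ge0.
  - by rewrite in_itv/= leey andbT lee_fin powR_ge0.
split=> //; split; first by case: f2.
apply: le_lt_trans fle _.
by rewrite lte_mul_pinfty// lee_fin powR_ge0.
Qed.
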